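(* Let $f\in\mathcal C^\infty_e$ be such that $\mho(f)$ is regular, where $f(x)=\sum_{i=1}^d h_i(x)x_i^2$, $H=(h_1,\dots,h_d)$, and let $\mathcal U_e'$ be the stratum of the universal stratification $\mathcal U_e$ containing $j^1H(0)$. Then $\mathcal U_e'$ is of codimension $d-1$ or $d$. In the former case, $\mho(f)$ is a one-dimensional manifold. In the latter case, $\mho(f)$ is a union of finitely many connected one-dimensional manifolds with the origin being a common boundary.
   Context: $\mathcal C^\infty_e$ is the ring of germs at $0\in\mathbb R^d$ of smooth real-valued functions $f$ with $f(0)=0$, $df(0)=0$. Tangency set: $\mho(f)=\{x : D_if(x)\,x_j=D_jf(x)\,x_i \text{ for all } i,j\in[d]\}$, considered as a set germ at $0$. Canonical stratification: a stratification of a subset $X$ of a manifold is a locally finite partition of $X$ into submanifolds (strata). To a Whitney (b)-regular stratification associate $X_i$ = union of strata of dimension $\le i$; put $\mathfrak X<\mathfrak X'$ if for some $i$, $X_i\subsetneq X_i'$ and $X_j=X_j'$ for all $j>i$. Every semialgebraic set has a minimal Whitney regular stratification (unique, with finitely many semialgebraic strata), called canonical. A map is transverse to a stratified set if it is transverse to each stratum. Regularity: elements of $\mathcal C^\infty_e$ are written in the form $f(x)=\sum_{i=1}^d h_i(x)x_i^2$ with $H=(h_1,\dots,h_d)$ a smooth map to $\mathbb R^d$. Define $u:J^1(\mathbb R^d,\mathbb R^d)\to J^1(\mathbb R^d,\mathbb R)=\mathbb R^d\times\mathbb R\times\mathbb R^d$ by $$u(x,h^0,H^1)=\Big(x,\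 \sum_{i=1}^d h^0_ix_i^2,\ \Big[2h^0_ix_i+\sum_{j=1}^dH^1_{ji}x_j^2\Big]_{i=1}^d\Big),$$ so that $j^1f=u\circ j^1H$. Let $Z=\{(x,g)\in\mathbb R^d\times\mathbb R^d:\operatorname{rank}[x\,|\,g]\le1\}$, regarded as a subset of $J^1(\mathbb R^d,\mathbb R)$ (no condition on the value coordinate), so that $\mho(f)=(j^1f)^{-1}(Z)=(j^1H)^{-1}(u^{-1}(Z))$. The universal stratification $\mathcal U_e$ is the canonical stratification of $u^{-1}(Z)\subseteq J^1(\mathbb R^d,\mathbb R^d)$, and codimension is taken in $J^1(\mathbb R^d,\mathbb R^d)$. $\mho(f)$ is regular (and $f$ is $\mho$-regular) if $j^1H$ is transverse to $\mathcal U_e$ (as a germ at $0$). *)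

(* Defs.v *)
From HB Require Import structures.
From mathcomp Require Export all_boot all_order all_algebra.
From mathcomp Require Export all_classical all_reals all_analysis.
Set Implicit Arguments.
Unset Strict Implicit.
Unset Printing Implicit Defensive.
Export Order.TTheory GRing.Theory Num.Theory numFieldNormedType.Exports.
#[export] Set Warnings "-notation-overridden".
Local Open Scope classical_set_scope.
Local Open Scope ring_scope.

(* Every normed module to which these definitions are applied (row vectors,
   matrices, products of such, R itself) is finite-dimensional, so all linear
   maps are continuous and pointwise continuity of [x |-> 'd f x v] for each
   [v] is continuity of the differential. *)

Section Smooth.
Context {R : realType}.

Fixpoint Ck {V W : normedModType R} (k : nat) (U : set V) (f : V -> W) : Prop :=
  if k is k'.+1 then
    (forall x, U x -> differentiable f x) /\
    (forall v, Ck k' U (fun x => 'd f x v))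
  else forall x, U x -> {for x, continuous f}.

Definition smooth_on {V W : normedModType R} (U : set V) (f : V -> W) : Prop :=
  forall k, Ck k U f.

Definition smooth_at {V W : normedModType R} (f : V -> W) (p : V) : Prop :=
  exists U, open_nbhs p U /\ smooth_on U f.

Definition diffeo_on {V W : normedModType R} (U : set V) (phi : V -> W) : Prop :=
  [/\ open U, open (phi @` U), smooth_on U phi &
      exists psi : W -> V,
        smooth_on (phi @` U) psi /\ (forall x, U x -> psi (phi x) = x)].

End Smooth.

Section Submanifolds.
Context {R : realType} {V : normedModType R}.
Implicit Types (M B : set V) (p v : V).

(* [0, +oo[ x R^(k-1) *)
Definition half_space (k : nat) : set 'rV[R]_k :=
  [set y | forall i : 'I_k, i = 0%N :> nat -> 0 <= y 0 i].

Definition slice_chart (k c : nat) (A : set 'rV[R]_k) M p : Prop :=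
  exists (U : set V) (phi : V -> 'rV[R]_k * 'rV[R]_c),
    [/\ U p, diffeo_on U phi, phi p = 0 &
        phi @` (M `&` U) = phi @` U `&` [set z | A z.1 /\ z.2 = 0]].

(* Embedded, without boundary, of dimension k and codimension c everywhere. *)
Definition submanifold (k c : nat) M : Prop :=
  forall p, M p -> slice_chart c [set: 'rV[R]_k] M p.

(* Embedded, with boundary B (which is part of M). *)
Definition submanifold_bd (k c : nat) M B : Prop :=
  [/\ B `<=` M,
      forall p, (M `\` B) p -> slice_chart c [set: 'rV[R]_k] M p &
      forall p, B p -> slice_chart c (@half_space k) M p].

Definition has_codim (c : nat) M : Prop := exists k, submanifold k c M.

Definition tangent M p : set V :=
  [set v | exists gamma : R -> V,
     [/\ smooth_at gamma 0, gamma 0 = p,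
         \forall t \near (0 : R), M (gamma t) &
         is_derive (0 : R) 1 gamma v]].

End Submanifolds.

Section Whitney.
Context {R : realType} {V : normedModType R}.
Implicit Types (T tau : set V) (S : set (set V)).

Definition is_basis (k : nat) T (b : 'I_k -> V) : Prop :=
  T = [set \sum_i a i *: b i | a in [set: 'I_k -> R]] /\
  (forall a : 'I_k -> R, \sum_i a i *: b i = 0 -> forall i, a i = 0).

(* Convergence in the Grassmannian of k-planes, topologized as the quotient of
   the space of k-frames; the quotient map has local sections, so a sequence
   of planes converges iff it lifts to a convergent sequence of frames. *)
Definition grass_cvg (T : nat -> set V) tau : Prop :=
  exists (k : nat) (b : nat -> 'I_k -> V) (b0 : 'I_k -> V),
    [/\ forall n, is_basis (T n) (b n), is_basis tau b0 &
        forall i, b n i @[n --> \oo] --> b0 i].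

Definition line (v : V) : set V := [set t *: v | t in [set: R]].

Definition whitney_b (X Y : set V) (p : V) : Prop :=
  forall (x y : nat -> V) (l tau : set V),
    (forall n, X (x n)) -> (forall n, Y (y n)) -> (forall n, x n <> y n) ->
    x @ \oo --> p -> y @ \oo --> p ->
    grass_cvg (fun n => line (x n - y n)) l ->
    grass_cvg (fun n => tangent X (x n)) tau ->
    l `<=` tau.

Definition stratification (X : set V) S : Prop :=
  [/\ X = \bigcup_(M in S) M,
      forall M, S M -> M !=set0 /\ exists k c, submanifold k c M,
      forall M N, S M -> S N -> M `&` N !=set0 -> M = N &
      forall p, X p -> exists U,
        open_nbhs p U /\ finite_set [set M | S M /\ M `&` U !=set0]].

Definition whitney_stratification (X : set V) S : Prop :=
  stratification X S /\
  forall M N, S M -> S N -> M <> N -> forall p, N p -> whitney_b M N p.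

Definition skeleton S (i : nat) : set V :=
  [set x | exists M, [/\ S M, M x &
                         exists k c, (k <= i)%N /\ submanifold k c M]].

Definition strat_lt S S' : Prop :=
  exists i, skeleton S i `<` skeleton S' i /\
            (forall j, (i < j)%N -> skeleton S j = skeleton S' j).

(* The order only sees the skeletons, so for a fixed [X] this determines [S] up
   to regrouping connected components of the sets
   [skeleton S i `\` skeleton S i.-1]. *)
Definition canonical_stratification (X : set V) S : Prop :=
  whitney_stratification X S /\
  (forall S', whitney_stratification X S' -> ~ strat_lt S' S).

Definition transverse_at {W : normedModType R} (F : W -> V) (M : set V) (x : W) :
    Prop :=
  M (F x) -> forall v : V, exists w t, tangent M (F x) t /\ v = 'd F x w + t.

Definition germ_transverse {W : normedModType R} (F : W -> V) S (x0 : W) : Prop :=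
  \forall x \near x0, forall M, S M -> transverse_at F M x.

End Whitney.

Notation basis_vec i := (delta_mx 0 i).

Section Tangency.
Context {R : realType} {d : nat}.

Definition in_Ce (f : 'rV[R]_d -> R) : Prop :=
  [/\ smooth_at f 0, f 0 = 0 & forall v, 'd f (0 : 'rV[R]_d) v = 0].

Definition mho (f : 'rV[R]_d -> R) : set 'rV[R]_d :=
  [set x | forall i j : 'I_d,
     'D_(basis_vec i) f x * x 0 j = 'D_(basis_vec j) f x * x 0 i].

End Tangency.

(* J^1(R^d,R) and J^1(R^d,R^d): source, value, first derivatives. *)
Notation J1R R d := ('rV[R]_d * R * 'rV[R]_d)%type.
Notation J1 R d := ('rV[R]_d * 'rV[R]_d * 'M[R]_d)%type.

Section Jets.
Context {R : realType} {d : nat}.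

(* [jacobian] acts on row vectors from the right, so its (i, j) entry is
   D_i H_j, whereas the matrix part of a 1-jet has (j, i) entry D_i H_j. *)
Definition jet1 (H : 'rV[R]_d -> 'rV[R]_d) (x : 'rV[R]_d) : J1 R d :=
  (x, H x, (jacobian H x)^T).

Definition u_map (z : J1 R d) : J1R R d :=
  let: (x, h, H1) := z in
  (x, \sum_i h 0 i * x 0 i ^+ 2,
   \row_i (2 * h 0 i * x 0 i + \sum_j H1 j i * x 0 j ^+ 2)).

Definition Z : set (J1R R d) :=
  [set z | (\rank (row_mx z.1.1^T z.2^T) <= 1)%N].

Definition is_universal_stratification (S : set (set (J1 R d))) : Prop :=
  canonical_stratification (u_map @^-1` Z) S.

(* Regularity of the tangency set of f(x) = \sum_i H_i(x) x_i^2. *)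
Definition mho_regular (S : set (set (J1 R d))) (H : 'rV[R]_d -> 'rV[R]_d) : Prop :=
  germ_transverse (jet1 H) S 0.

End Jets.

(* Main.v *)
(* Let X = u^{-1}(Z) and E = {x = 0}, a subset of X.  At a point of X with x <> 0
   the d - 1 equations g_i x_j = g_j x_i (i fixed, x_i <> 0) are independent, so
   no stratum has codimension < d - 1; transversality at 0 gives codimension <= d.
   Condition (b) forces the strata adherent to a stratum N to have larger
   dimension and their tangent planes to converge to planes containing TN.
   Hence a stratum N of codimension d - 1 is open in X.  For d > 1 it cannot meet
   E: nearby points of E with distinct h_i lie in N, and there TN would contain
   TE and the velocities of d curves of X, i.e. everything.  A stratum of
   codimension d through (0, h, H1) thus contains E near that point.  If
   h_a = h_b, there is a curve of X along which the linearised equation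
   g_a x_b = g_b x_a, rescaled, tends to an equation violated by TE; so the h_i
   are distinct.  Then, in the coordinates x = t (e_i + w), the tangency
   equations become w = t P(t, w) with P smooth, whose solution w = omega_i(t)
   parametrises the two half-branches of the tangency set tangent to e_i. *)

Require Import Defs.
From HB Require Import structures.
From mathcomp Require Import ring lra.
Set Implicit Arguments.
Unset Strict Implicit.
Unset Printing Implicit Defensive.
Local Open Scope classical_set_scope.
Local Open Scope ring_scope.

(** * Calculus of C^k maps between finite-dimensional normed modules *)

Section FinDim.
Context {R : realType}.
Implicit Types V W : normedModType R.

(** On E all g_i and all x_j vanish, so the equations g_i x_j = g_j x_i have zero differential there
    and say nothing about the tangent space of a stratum at j^1H(0). All information on E is a limit
    taken from points of X with x <> 0; this is why explicit curves in X are constructed. Tangent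
    planes along such a curve need not converge, so condition (b) becomes usable only after
    extracting a subsequence with convergent bases. The distinct h_i are what makes the last step
    possible: the quadratic part of f is sum h_i(0) x_i^2, whose tangency set is then the union of
    the d axes, and w = t P(t, w) exhibits the tangency set of f as a perturbation of these axes.
    The coordinates (t, w) for the index i are used in the cone |x_j| <= |x_i|; the d cones cover
    everything, so no branch is missed. For d = 1 there is no equation at all, and codimension d - 1
    = 0 is not excluded at points of E; that case is treated apart. *)

Definition fin_dim V : Prop :=
  exists (I : finType) (e : I -> V) (c : I -> {linear V -> R}),
    (forall i, continuous (c i)) /\ forall v, v = \sum_i c i v *: e i.

Lemma fin_dim_R : fin_dim R.
Proof.
exists unit, (fun _ => 1), (fun _ => idfun : {linear R -> R}); split.
  by move=> _ x; exact: cvg_id.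
by move=> v; rewrite big_const card_unit /= addr0 [LHS](esym (mulr1 v)).
Qed.

Lemma mx_coord_subproof m n i j : linear (fun M : 'M[R]_(m, n) => M i j).
Proof. by move=> a u v; rewrite !mxE. Qed.

Definition mx_coord m n i j : {linear 'M[R]_(m, n) -> R} :=
  HB.pack (fun M : 'M[R]_(m, n) => M i j)
    (GRing.isLinear.Build _ _ _ _ _ (@mx_coord_subproof m n i j)).

Lemma fin_dim_mx m n : fin_dim 'M[R]_(m, n).
Proof.
exists ('I_m * 'I_n)%type, (fun p => delta_mx p.1 p.2), (fun p => mx_coord p.1 p.2); split.
  by move=> p x; exact: coord_continuous.
by move=> v; rewrite {1}[v]matrix_sum_delta pair_bigA.
Qed.

Lemma fin_dim_prod V W : fin_dim V -> fin_dim W -> fin_dim (V * W)%type.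
Proof.
move=> [I [e [c [cc cE]]]] [J [e' [c' [cc' cE']]]].
pose e2 k := match k with inl i => (e i, 0 : W) | inr j => (0 : V, e' j) end.
pose c2 k : (V * W)%type -> R := match k with inl i => c i \o fst | inr j => c' j \o snd end.
have cl k : linear (c2 k).
  by case: k => k a u v /=; rewrite linearP.
pose cL k : {linear (V * W)%type -> R} :=
  HB.pack (c2 k) (GRing.isLinear.Build _ _ _ _ _ (cl k)).
exists (I + J)%type, e2, cL; split.
  case=> k /= x.
    apply: (@continuous_comp _ _ _ fst (c k)); [exact: cvg_fst|exact: cc].
  apply: (@continuous_comp _ _ _ snd (c' k)); [exact: cvg_snd|exact: cc'].
move=> [v w]; rewrite big_sumType /=.
have sumE (K : finType) (u : K -> V) (w' : K -> W) :
    \sum_k ((u k, w' k) : V * W) = (\sum_k u k, \sum_k w' k).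
  by elim/big_rec3: _ => // k x y z _ ->.
transitivity ((v, 0 : W) + (0 : V, w)).
  by congr pair; rewrite ?addr0 ?add0r.
congr (_ + _).
  transitivity (\sum_i ((c i v *: e i, 0 : W) : V * W)).
    by rewrite sumE -cE big1_eq.
  by apply: eq_bigr => i _; congr pair; rewrite scaler0.
transitivity (\sum_i ((0 : V, c' i w *: e' i) : V * W)).
  by rewrite sumE -cE' big1_eq.
by apply: eq_bigr => i _; congr pair; rewrite scaler0.
Qed.

Lemma linear_fin_dim_continuous V W (L : {linear V -> W}) : fin_dim V -> continuous L.
Proof.
move=> [I [e [c [cc cE]]]].
have -> : (L : V -> W) = fun v => \sum_i c i v *: L (e i).
  by apply/funext => v; rewrite {1}[v]cE linear_sum; apply: eq_bigr => i _; rewrite linearZ.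
apply: (@continuous_big W I +%R 0 xpredT _ V); first exact: add_continuous.
by move=> i _ v; apply: cvgZr_tmp; exact: cc.
Qed.
End FinDim.

Section DiffEps.
Context {R : realType}.
Implicit Types V W X : normedModType R.

Lemma differentiable_eps V W (f : V -> W) x : differentiable f x ->
  forall e, 0 < e -> \forall y \near x, `|f y - f x - 'd f x (y - x)| <= e * `|y - x|.
Proof.
move=> /diffP[_ /= h] e e0.
have : f = (fun y => f (lim (nbhs x)) + 'd f x (y - lim (nbhs x)))
    +o_ (nbhs x) (fun y => y - lim (nbhs x)).
  by apply/funext => y; exact: h.
move=> /eqaddoP /(_ e e0); rewrite lim_id//; apply: filterS => y.
by rewrite /= opprD addrA.
Qed.

Lemma is_diff_eps V W (f : V -> W) (L : {linear V -> W}) x : continuous L ->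
  (forall e, 0 < e -> \forall y \near x, `|f y - f x - L (y - x)| <= e * `|y - x|) ->
  is_diff x f L.
Proof.
move=> cL h.
have H : f \o shift x = cst (f x) + L +o_ 0 id.
  apply/eqaddoP => e e0.
  have := h e e0; rewrite (near_shift 0) /=; apply: filterS => y /=.
  by rewrite subr0 addrK opprD addrA.
apply: DiffDef; last exact: diff_unique.
apply/diff_locallyP; rewrite (diff_unique cL H); split => //.
Qed.

Lemma near_eq_is_diff V W (f g : V -> W) x : (\forall y \near x, f y = g y) ->
  differentiable f x -> is_diff x g ('d f x).
Proof.
move=> fg df; apply: is_diff_eps => [|e e0]; first exact: diff_continuous.
have fx : f x = g x by exact: nbhs_singleton fg.
move: (differentiable_eps df e0); apply: filterS2 fg => y fgy.
by rewrite -fgy -fx.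
Qed.

End DiffEps.

Section CkCalculus.
Context {R : realType}.
Implicit Types V W X : normedModType R.

Lemma open_near V (U : set V) (P : set V) x : open U -> U x -> (forall y, U y -> P y) ->
  \forall y \near x, P y.
Proof.
move=> oU Ux h; have : nbhs x U by exact: open_nbhs_nbhs.
exact: filterS.
Qed.

Lemma Ck_sub V W k (U U' : set V) (f : V -> W) :
  U' `<=` U -> Ck k U f -> Ck k U' f.
Proof.
move=> UU'; elim: k f => [|k IH] f /=; first by move=> h x /UU'/h.
by move=> [df h]; split => [x /UU'/df //|v]; exact/IH/h.
Qed.

Lemma Ck_ext V W k (U : set V) (f g : V -> W) :
  open U -> (forall x, U x -> f x = g x) -> Ck k U f -> Ck k U g.
Proof.
move=> oU; elim: k f g => [|k IH] f g fg /=.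
  move=> h x Ux; change (g @ x --> g x); rewrite -(fg x Ux).
  apply: cvg_trans (h x Ux); apply: near_eq_cvg.
  by apply: (open_near oU Ux) => y /fg.
move=> [df h].
have E x : U x -> is_diff x g ('d f x).
  move=> Ux; apply: near_eq_is_diff; last exact: df.
  exact: (open_near oU Ux).
split => [x Ux|v]; first by have [] := E x Ux.
apply: IH (h v) => x Ux /=.
by have [_ ->] := E x Ux.
Qed.

Lemma Ck_continuous V W k (U : set V) (f : V -> W) x :
  Ck k U f -> U x -> {for x, continuous f}.
Proof.
case: k => [|k] /=; first by apply.
by move=> [df _] /df /differentiable_continuous.
Qed.

Lemma CkS V W k (U : set V) (f : V -> W) : Ck k.+1 U f -> Ck k U f.
Proof.
elim: k f => [|k IH] f; first by move=> h x Ux; exact: Ck_continuous h Ux.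
by move=> [df h]; split => // v; exact/IH/h.
Qed.

Lemma Ck_cst V W k (U : set V) (a : W) : Ck k U (fun=> a).
Proof.
elim: k a => [|k IH] a /=; first by move=> x _; exact: cvg_cst.
split => [x _|v]; first exact: differentiable_cst.
have -> : (fun x : V => 'd (fun=> a) x v) = fun=> 0.
  by apply/funext => x; rewrite (diff_cst a x).
exact: IH.
Qed.

Lemma Ck_lin V W k (U : set V) (L : {linear V -> W}) : continuous L -> Ck k U L.
Proof.
case: k => [|k] cL /=; first by move=> x _; exact: cL.
split => [x _|v]; first exact: linear_differentiable.
have -> : (fun x : V => 'd L x v) = fun=> L v.
  by apply/funext => x; rewrite diff_lin.
exact: Ck_cst.
Qed.

Section Open.
Variables (V : normedModType R) (U : set V).
Hypothesis oU : open U.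

(** [Ck] tests the total function ['d f]; on an open set only its values there count, so any formula
    [df] for the differential on U may replace it. The induction steps below exhibit such a
    formula. *)
Lemma Ck_diff W k (f : V -> W) (df : V -> V -> W) :
  (forall x, U x -> is_diff x f (df x)) -> (forall v, Ck k U (df^~ v)) ->
  Ck k.+1 U f.
Proof.
move=> h hk; split => [x /h[]//|v]; apply: Ck_ext (hk v) => // x Ux.
by have [_ ->] := h x Ux.
Qed.

Lemma Ck_is_diff W k (f : V -> W) x : Ck k.+1 U f -> U x -> is_diff x f ('d f x).
Proof. by move=> [h _] Ux; apply/differentiableP; exact: h. Qed.

Lemma Ck_lin_comp W X k (L : {linear W -> X}) (f : V -> W) :
  continuous L -> Ck k U f -> Ck k U (L \o f).
Proof.
move=> cL; elim: k f => [|k IH] f.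
  by move=> h x Ux; apply: continuous_comp; [exact: h|exact: cL].
move=> hf; apply: (@Ck_diff _ _ _ (fun x => L \o 'd f x)) => [x Ux|v].
  have h1 := Ck_is_diff hf Ux.
  have h2 : is_diff (f x) L L.
    by apply: DiffDef; [exact: linear_differentiable|exact: diff_lin].
  exact: is_diff_comp.
by have [_ h] := hf; exact: (IH _ (h v)).
Qed.

Lemma Ck_add W k (f g : V -> W) : Ck k U f -> Ck k U g -> Ck k U (fun x => f x + g x).
Proof.
elim: k f g => [|k IH] f g.
  by move=> hf hg x Ux; apply: cvgD; [exact: hf|exact: hg].
move=> hf hg.
apply: (@Ck_diff _ _ _ (fun x v => 'd f x v + 'd g x v)) => [x Ux|v].
  have h1 := Ck_is_diff hf Ux; have h2 := Ck_is_diff hg Ux; exact: is_diffD.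
by have [[_ h1] [_ h2]] := (hf, hg); exact: (IH _ _ (h1 v) (h2 v)).
Qed.

Lemma Ck_opp W k (f : V -> W) : Ck k U f -> Ck k U (fun x => - f x).
Proof.
by move=> h; apply: (@Ck_lin_comp _ _ _ -%R f) => //; exact: opp_continuous.
Qed.

Lemma Ck_sum W k (I : Type) (r : seq I) (P : pred I) (f : I -> V -> W) :
  (forall i, Ck k U (f i)) -> Ck k U (fun x => \sum_(i <- r | P i) f i x).
Proof.
move=> h; elim: r => [|i r IH].
  by apply: (Ck_ext oU _ (Ck_cst k U 0)) => x _; rewrite big_nil.
case: (boolP (P i)) => Pi.
  by apply: (Ck_ext oU _ (Ck_add (h i) IH)) => x _; rewrite big_cons Pi.
by apply: (Ck_ext oU _ IH) => x _; rewrite big_cons (negbTE Pi).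
Qed.

Lemma Ck_mul k (f g : V -> R) : Ck k U f -> Ck k U g -> Ck k U (fun x => f x * g x).
Proof.
elim: k f g => [|k IH] f g.
  by move=> hf hg x Ux; apply: cvgM; [exact: hf|exact: hg].
move=> hf hg.
apply: (@Ck_diff _ _ _ (fun x v => f x * 'd g x v + g x * 'd f x v)) => [x Ux|v].
  have h1 := Ck_is_diff hf Ux; have h2 := Ck_is_diff hg Ux; exact: is_diffM.
have [hf' hg'] := (CkS hf, CkS hg).
have [[_ h1] [_ h2]] := (hf, hg).
by apply: (Ck_add (IH _ _ hf' (h2 v)) (IH _ _ hg' (h1 v))).
Qed.

Lemma Ck_prod k (I : Type) (r : seq I) (P : pred I) (f : I -> V -> R) :
  (forall i, Ck k U (f i)) -> Ck k U (fun x => \prod_(i <- r | P i) f i x).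
Proof.
move=> h; elim: r => [|i r IH].
  by apply: (Ck_ext oU _ (Ck_cst k U (1 : R))) => x _; rewrite big_nil.
case: (boolP (P i)) => Pi.
  by apply: (Ck_ext oU _ (Ck_mul (h i) IH)) => x _; rewrite big_cons Pi.
by apply: (Ck_ext oU _ IH) => x _; rewrite big_cons (negbTE Pi).
Qed.

Lemma Ck_inv k (f : V -> R) : (forall x, U x -> f x != 0) -> Ck k U f ->
  Ck k U (fun x => (f x)^-1).
Proof.
move=> f0; elim: k => [|k IH].
  by move=> hf x Ux; apply: cvgV; [exact: f0|exact: hf].
move=> hf.
apply: (@Ck_diff _ _ _ (fun x v => - ((f x)^-1 * (f x)^-1 * 'd f x v))) => [x Ux|v].
  have [h _] := Ck_is_diff hf Ux; apply: DiffDef.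
    by apply: differentiableV => //; exact: f0.
  by rewrite diffV ?f0//; apply/funext => v /=; rewrite -mulNr -expr2 exprVn.
have hf' := IH (CkS hf).
have [_ h1] := hf.
exact: (Ck_opp (Ck_mul (Ck_mul hf' hf') (h1 v))).
Qed.

Lemma Ck_scalel W k (f : V -> R) (w : W) : Ck k U f -> Ck k U (fun x => f x *: w).
Proof.
have lin : linear ( *:%R ^~ w : R -> W).
  by move=> a u v; rewrite scalerDl scalerA.
pose L : {linear R -> W} := HB.pack ( *:%R ^~ w : R -> W) (GRing.isLinear.Build _ _ _ _ _ lin).
move=> h; apply: (@Ck_lin_comp _ _ _ L f) => // x.
by apply: cvgZr_tmp; exact: cvg_id.
Qed.

Lemma Ck_coords W k (I : finType) (e : I -> W) (c : I -> {linear W -> R}) (f : V -> W) :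
  (forall w, w = \sum_i c i w *: e i) -> (forall i, Ck k U (c i \o f)) -> Ck k U f.
Proof.
move=> cE h.
have H : Ck k U (fun x => \sum_i c i (f x) *: e i).
  by apply: Ck_sum => i; apply: Ck_scalel; exact: h.
by apply: (Ck_ext oU _ H) => x _; rewrite -cE.
Qed.

End Open.

(** In ['d f (g x) ('d g x v)] the direction moves with x, whereas [Ck] fixes it. Coordinates on W
    split this into a finite sum of products with fixed directions [a j]; these products are scalar,
    so f is first replaced by its coordinates. *)
Lemma Ck_comp V W X k (U : set V) (U' : set W) (f : W -> X) (g : V -> W) :
  open U -> open U' -> fin_dim W -> fin_dim X ->
  (forall x, U x -> U' (g x)) -> Ck k U' f -> Ck k U g -> Ck k U (f \o g).
Proof.
move=> oU oU' fW [I [e [c [cc cE]]]] UU' hf hg.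
apply: (Ck_coords oU cE) => i.
have : Ck k U' (c i \o f) by exact: Ck_lin_comp.
change (Ck k U' (c i \o f) -> Ck k U ((c i \o f) \o g)).
move: (c i \o f : W -> R) => {hf}f hf.
have [J [a [b [bc bE]]]] := fW.
elim: k f hf hg => [|k IH] f hf hg.
  by move=> x Ux; apply: continuous_comp; [exact: hg|exact/hf/UU'].
apply: (Ck_diff oU (df := fun x v => \sum_j b j ('d g x v) * 'd f (g x) (a j))) => // [x Ux|v].
  have h1 := Ck_is_diff hg Ux; have h2 := Ck_is_diff hf (UU' _ Ux).
  have [h3 h4] := is_diff_comp h1 h2; apply: DiffDef => //; rewrite h4; apply/funext => v /=.
  rewrite {1}(bE ('d g x v)) linear_sum; apply: eq_bigr => j _.
  by rewrite linearZ.
apply: Ck_sum => // j; apply: Ck_mul => //.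
  by have [_ h1] := hg; exact: (Ck_lin_comp oU (bc j) (h1 v)).
have [_ h1] := hf.
exact: (IH _ (h1 (a j)) (CkS hg)).
Qed.

End CkCalculus.

Section CkMore.
Context {R : realType}.
Variables (V : normedModType R) (U : set V).
Hypothesis oU : open U.

Lemma Ck_id k : Ck k U (id : V -> V).
Proof. by apply: (@Ck_lin _ _ _ _ _ (idfun : {linear V -> V})) => x; exact: cvg_id. Qed.

Lemma Ck_mx k m n (f : V -> 'M[R]_(m, n)) :
  (forall i j, Ck k U (fun x => f x i j)) -> Ck k U f.
Proof.
move=> h; have H : Ck k U (fun x => \sum_i \sum_j f x i j *: delta_mx i j : 'M[R]_(m, n)).
  by do 2 apply: Ck_sum => // ?; exact: Ck_scalel.
by apply: (Ck_ext oU _ H) => x _; rewrite -matrix_sum_delta.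
Qed.

Lemma Ck_coord k m n (f : V -> 'M[R]_(m, n)) i j : Ck k U f -> Ck k U (fun x => f x i j).
Proof.
by apply: (Ck_lin_comp oU (L := mx_coord i j)) => M; exact: coord_continuous.
Qed.

Lemma Ck_pair (W X : normedModType R) k (f : V -> W) (g : V -> X) : Ck k U f -> Ck k U g ->
  Ck k U (fun x => (f x, g x)).
Proof.
elim: k f g => [|k IH] f g hf hg; first by move=> x Ux; apply: cvg_pair; [exact: hf|exact: hg].
apply: (Ck_diff oU (df := fun x v => ('d f x v, 'd g x v))) => [x Ux|v].
  have h1 := Ck_is_diff hf Ux; have h2 := Ck_is_diff hg Ux; exact: is_diff_pair.
by have [[_ h1] [_ h2]] := (hf, hg); exact: (IH _ _ (h1 v) (h2 v)).
Qed.

Lemma Ck_fst (W X : normedModType R) k (f : V -> (W * X)%type) :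
  Ck k U f -> Ck k U (fun x => (f x).1).
Proof. by apply: (Ck_lin_comp oU (L := fst : {linear (W * X)%type -> W})) => x; exact: cvg_fst. Qed.

Lemma Ck_snd (W X : normedModType R) k (f : V -> (W * X)%type) :
  Ck k U f -> Ck k U (fun x => (f x).2).
Proof. by apply: (Ck_lin_comp oU (L := snd : {linear (W * X)%type -> X})) => x; exact: cvg_snd. Qed.

End CkMore.

(** * Strict differentiability of C^1 maps *)

Section Strict.
Context {R : realType}.
Implicit Types V W : normedModType R.

(** One K serves all L: values on finitely many vectors control the operator norm. This upgrades
    continuity of ['d f x v] in x, for each v, to continuity in operator norm ([diff_near]). *)
Lemma fin_dim_linear_le V W : fin_dim V -> exists (I : finType) (a : I -> V) (K : R),
  0 < K /\ forall (L : {linear V -> W}) e, 0 <= e -> (forall i, `|L (a i)| <= e) ->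
  forall v, `|L v| <= K * e * `|v|.
Proof.
move=> [I [a [c [cc cE]]]].
have /choice[k kP] : forall i, exists k : R, 0 < k /\ forall v, `|c i v| <= k * `|v|.
  by move=> i; have [k k0 h] := linear_lipschitz (cc i); exists k.
exists I, a, (\sum_i k i + 1); split.
  rewrite ltr_wpDl//; apply: sumr_ge0 => i _; apply: ltW; by case: (kP i).
move=> L e e0 h v; rewrite {1}(cE v) linear_sum.
apply: (le_trans (ler_norm_sum _ _ _)).
apply: (@le_trans _ _ (\sum_i k i * e * `|v|)).
  apply: ler_sum => i _; rewrite linearZ normrZ -mulrAC.
  by apply: ler_pM => //; case: (kP i).
rewrite -!mulr_suml; apply: ler_wpM2r => //; apply: ler_wpM2r => //.
by rewrite lerDl.
Qed.

Lemma diff_near V W (U : set V) (f : V -> W) p e : fin_dim V -> open U -> Ck 1 U f -> U p ->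
  0 < e -> \forall z \near p, forall v, `|'d f z v - 'd f p v| <= e * `|v|.
Proof.
move=> fV oU hf Up e0; have [I [a [K [K0 h]]]] := fin_dim_linear_le W fV.
have : \forall z \near p, forall i, `|'d f z (a i) - 'd f p (a i)| <= e / K.
  apply: filter_forall => i; have [_ /(_ (a i) p Up)] := hf.
  move=> /cvgrPdist_le /(_ (e / K)); rewrite divr_gt0// => /(_ isT).
  by apply: filterS => z; rewrite distrC.
apply: filterS => z hz v.
have := h ('d f z \- 'd f p) (e / K).
rewrite ltW ?divr_gt0// => /(_ isT hz v) /=.
by rewrite mulrCA divff ?gt_eqF// mulr1.
Qed.

Lemma is_diff_is_derive V W (f df : V -> W) x v : is_diff x f df -> is_derive x v f (df v).
Proof.
by move=> [h <-]; apply: DeriveDef; [exact: diff_derivable|exact: deriveE].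
Qed.

Lemma is_derive_comp_diff V W (g : R -> V) (f : V -> W) (t : R) v :
  is_derive t 1 g v -> differentiable f (g t) ->
  is_derive t 1 (f \o g) ('d f (g t) v).
Proof.
move=> [dg <-] df.
have gd : differentiable g t by exact/derivable1_diffP.
have h := is_diff_is_derive (1 : R) (differentiableP (differentiable_comp gd df)).
by move: h; rewrite diff_comp// deriveE.
Qed.

Lemma is_derive_line V (y w : V) (t : R) : is_derive t 1 (fun t => y + t *: w) w.
Proof.
have lin : linear ( *:%R ^~ w : R -> V).
  by move=> a u v; rewrite scalerDl scalerA.
pose L : {linear R -> V} := HB.pack ( *:%R ^~ w : R -> V) (GRing.isLinear.Build _ _ _ _ _ lin).
have cL : continuous L by move=> x; apply: cvgZr_tmp; exact: cvg_id.
have h : is_diff t L L by apply: DiffDef; [exact: linear_differentiable|exact: diff_lin].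
have := is_deriveD (is_derive_cst y t (1 : R)) (is_diff_is_derive (1 : R) h).
by rewrite /= scale1r add0r.
Qed.

Lemma ball_segment V (p x y : V) d t : 0 <= t <= 1 -> ball p d x -> ball p d y ->
  ball p d (y + t *: (x - y)).
Proof.
move=> /andP[t0 t1]; rewrite -!ball_normE /= => px py.
have -> : p - (y + t *: (x - y)) = t *: (p - x) + (1 - t) *: (p - y).
  rewrite -[x in LHS](subKr p) -[y in LHS](subKr p).
  move: (p - x) (p - y) => a b.
  have -> : p - a - (p - b) = b - a by rewrite opprB addrC addrA subrK.
  by rewrite opprD opprB addrA [p + _]addrC subrK scalerBl scale1r scalerBr opprB addrCA.
apply: (le_lt_trans (ler_normD _ _)); rewrite !normrZ (ger0_norm t0) ger0_norm ?subr_ge0//.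
have -> : d = t * d + (1 - t) * d by rewrite -mulrDl subrKC mul1r.
have [->|tn] := eqVneq t 0; first by rewrite !mul0r !add0r subr0 !mul1r.
apply: ltr_leD; last by rewrite ler_wpM2l// ?subr_ge0// ltW.
by rewrite ltr_pM2l// lt_neqAle eq_sym tn.
Qed.

(** The mean value theorem on the segment from y to x produces one point c with f x - f y =
    ['d f c (x - y)], and [diff_near] compares c with p. Values are real because c would otherwise
    depend on the coordinate. Both x and y move, as secants between two moving points require. *)
Lemma strict_diff_real V (U : set V) (f : V -> R) p e : fin_dim V -> open U -> Ck 1 U f ->
  U p -> 0 < e -> exists2 d, 0 < d & forall x y, ball p d x -> ball p d y ->
  `|f x - f y - 'd f p (x - y)| <= e * `|x - y|.
Proof.
move=> fV oU hf Up e0.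
have : \forall z \near p, U z /\ forall v, `|'d f z v - 'd f p v| <= e * `|v|.
  by apply: filterI; [exact: open_nbhs_nbhs|exact: diff_near hf _ _].
move=> /nbhs_ballP[d /= d0 hd]; exists d => // x y px py.
pose g t := f (y + t *: (x - y)).
have bt (t : R) (t01 : 0 <= t <= 1) := ball_segment t01 px py.
have gd (t : R) : 0 <= t <= 1 -> is_derive t 1 g ('d f (y + t *: (x - y)) (x - y)).
  move=> /bt/hd[Ut _]; have [df _] := hf.
  apply: (is_derive_comp_diff (g := fun t => y + t *: (x - y))); last exact: df.
  exact: is_derive_line.
have [||c] := @MVT_segment R g (fun t => 'd f (y + t *: (x - y)) (x - y)) 0 1 ler01.
- by move=> t; rewrite in_itv/= => /andP[t0 t1]; apply: gd; rewrite !ltW.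
- apply: derivable_within_continuous => t; rewrite in_itv/= => t01.
  by have [] := gd t t01.
rewrite in_itv/= => /bt/hd[Uc hc].
rewrite /g scale1r scale0r addr0 subrKC subr0 mulr1 => ->.
exact: hc.
Qed.

Lemma strict_diff V W (U : set V) (f : V -> W) p e : fin_dim V -> fin_dim W ->
  open U -> Ck 1 U f ->
  U p -> 0 < e -> exists2 d, 0 < d & forall x y, ball p d x -> ball p d y ->
  `|f x - f y - 'd f p (x - y)| <= e * `|x - y|.
Proof.
move=> fV [I [a [c [cc cE]]]] oU hf Up e0.
pose K := \sum_i `|a i| + 1.
have K0 : 0 < K by rewrite ltr_wpDl//; exact: sumr_ge0.
have /choice[d dP] : forall i, exists d, 0 < d /\ forall x y, ball p d x -> ball p d y ->
  `|c i (f x - f y - 'd f p (x - y))| <= e / K * `|x - y|.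
  move=> i; have hfi : Ck 1 U (c i \o f) by exact: Ck_lin_comp.
  have [d d0 hd] := strict_diff_real fV oU hfi Up (divr_gt0 e0 K0).
  exists d; split => // x y px py; have := hd x y px py.
  have df : differentiable f p by case: hf => h _; exact: h.
  rewrite diff_comp//; last exact: linear_differentiable.
  by rewrite /= diff_lin// !linearB.
have : \forall d0 \near 0^'+, forall i, d0 <= d i.
  by apply: filter_forall => i; apply: nbhs_right_le; case: (dP i).
move=> /(filterI (nbhs_right_gt 0)) /filter_ex[/= d0 [d00 d0d]].
exists d0 => // x y px py; rewrite (cE (_ - _)).
apply: (le_trans (ler_norm_sum _ _ _)).
apply: (@le_trans _ _ (\sum_i (e / K * `|x - y|) * `|a i|)).
  apply: ler_sum => i _; rewrite normrZ; apply: ler_wpM2r => //.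
  by case: (dP i) => _; apply; [exact: le_ball (d0d i) _ px|exact: le_ball (d0d i) _ py].
rewrite -mulr_sumr mulrAC; apply: ler_wpM2r => //.
rewrite mulrAC ler_pdivrMr//; apply: ler_wpM2l; first exact: ltW.
by rewrite lerDl.
Qed.

Lemma locally_lipschitz V W (U : set V) (f : V -> W) p : fin_dim V -> fin_dim W ->
  open U -> Ck 1 U f -> U p -> exists K, 0 < K /\
  exists2 d, 0 < d & forall x y, ball p d x -> ball p d y ->
  `|f x - f y| <= K * `|x - y|.
Proof.
move=> fV fW oU hf Up.
have [d d0 hd] := strict_diff fV fW oU hf Up ltr01.
have df : differentiable f p by case: hf => h _; exact: h.
have [k k0 hk] := linear_lipschitz (diff_continuous df).
exists (1 + k); split; first by rewrite addr_gt0.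
exists d => // x y px py; rewrite -[f x - f y](subrK ('d f p (x - y))).
by rewrite mulrDl; apply: (le_trans (ler_normD _ _)); apply: lerD => //; exact: hd.
Qed.

End Strict.

(** * Subsequences in finite dimension *)

Section BolzanoWeierstrass.
Context {R : realType}.

(** Subsequences are represented by maps s tending to infinity, monotone or not: this is stable
    under composition and suffices for passing to limits. *)
Lemma increasing_seq_cvgny (s : nat -> nat) : increasing_seq s -> s @ \oo --> \oo.
Proof.
move=> si; have sn n : (n <= s n)%N.
  elim: n => // n IH; apply: (leq_ltn_trans IH).
  by rewrite ltnNge; apply/negP; rewrite -leEnat si ltnn.
by apply/cvgnyPge => A; exists A => // n /= An; exact: leq_trans (sn n).
Qed.

Lemma bolzano_weierstrass_family (I : finType) (u : I -> nat -> R) (B : R) :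
  (forall i n, `|u i n| <= B) -> exists2 s : nat -> nat, s @ \oo --> \oo &
  forall i, cvgn (u i \o s).
Proof.
move=> uB.
suff : forall r : seq I, exists2 s : nat -> nat, s @ \oo --> \oo &
  forall i, i \in r -> cvgn (u i \o s).
  by move=> /(_ (enum I))[s soo h]; exists s => // i; apply: h; rewrite mem_enum.
elim => [|i r [s soo hs]]; first by exists id => //; exact: cvg_id.
have [|s' /increasing_seq_cvgny s'oo cs'] := @bolzano_weierstrass R (u i \o s).
  by exists B; split => [|x Bx n _]; [exact: num_real|exact: le_trans (uB _ _) (ltW Bx)].
have ss' : s \o s' @ \oo --> \oo by exact: cvg_comp s'oo soo.
exists (s \o s') => // j; rewrite inE => /orP[/eqP->//|/hs /cvg_ex[l hl]].
by apply/cvg_ex; exists l; exact: cvg_comp s'oo hl.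
Qed.

Lemma fin_dim_subsequence (V : normedModType R) (u : nat -> V) (B : R) : fin_dim V ->
  (forall n, `|u n| <= B) -> exists2 s : nat -> nat, s @ \oo --> \oo & cvgn (u \o s).
Proof.
move=> [I [a [c [cc cE]]]] uB.
have /choice[k kP] : forall i, exists k : R, 0 < k /\ forall v, `|c i v| <= k * `|v|.
  by move=> i; have [k k0 h] := linear_lipschitz (cc i); exists k.
have [|s soo hs] := @bolzano_weierstrass_family I (fun i n => c i (u n)) ((\sum_i k i) * B).
  move=> i n; have [ki0 kv] := kP i; apply: (le_trans (kv _)).
  apply: ler_pM => //; first exact: ltW.
  by rewrite (bigD1 i)//= lerDl; apply: sumr_ge0 => j _; apply: ltW; case: (kP j).
exists s => //; apply/cvg_ex; exists (\sum_i lim ((fun n => c i (u n)) \o s @ \oo) *: a i).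
have -> : u \o s = fun n => \sum_i c i (u (s n)) *: a i by apply/funext => n /=; rewrite -cE.
apply: (@cvg_big V I +%R 0 xpredT); first exact: add_continuous.
by move=> i _; apply: cvgZr_tmp; exact: hs.
Qed.

End BolzanoWeierstrass.

(** * Grassmannians and Whitney's condition (b) *)

Section LinearAlgebra.
Context {R : realType}.

Lemma linear_rV_inj_le m n (f : {linear 'rV[R]_m -> 'rV[R]_n}) :
  (forall x, f x = 0 -> x = 0) -> (m <= n)%N.
Proof.
move=> finj; have : row_free (lin1_mx f).
  by apply/inj_row_free => x; rewrite mul_rV_lin1; exact: finj.
by rewrite /row_free => /eqP <-; exact: rank_leq_col.
Qed.

Lemma linear_rV_surj_le m n (f : {linear 'rV[R]_m -> 'rV[R]_n}) :
  (forall y, exists x, f x = y) -> (n <= m)%N.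
Proof.
move=> /choice[g gP].
have H : (\matrix_(i < n) g (delta_mx 0 i)) *m lin1_mx f = 1%:M.
  by apply/row_matrixP => i; rewrite row_mul rowK mul_rV_lin1 gP row1.
have := mxrankM_maxr (\matrix_(i < n) g (delta_mx 0 i)) (lin1_mx f).
by rewrite H mxrank1 => /leq_trans; apply; exact: rank_leq_row.
Qed.

Lemma linear_rV_prod_inj_le k c k' c'
    (f : {linear ('rV[R]_k * 'rV[R]_c)%type -> ('rV[R]_k' * 'rV[R]_c')%type}) :
  (forall x, f x = 0 -> x = 0) -> (k + c <= k' + c')%N.
Proof.
move=> finj.
pose g (x : 'rV[R]_(k + c)) : 'rV[R]_(k' + c') :=
  row_mx (f (lsubmx x, rsubmx x)).1 (f (lsubmx x, rsubmx x)).2.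
have glin : linear g.
  move=> a u v; rewrite /g scale_row_mx add_row_mx.
  have -> : (lsubmx (a *: u + v), rsubmx (a *: u + v)) =
    a *: (lsubmx u, rsubmx u) + (lsubmx v, rsubmx v) by congr pair; rewrite linearP.
  by rewrite linearP.
pose G : {linear 'rV[R]_(k + c) -> 'rV[R]_(k' + c')} :=
  HB.pack g (GRing.isLinear.Build _ _ _ _ _ glin).
apply: (linear_rV_inj_le (f := G)) => x; rewrite /G /= /g -row_mx0.
move=> /eq_row_mx[h1 h2]; have /finj[hl hr] : f (lsubmx x, rsubmx x) = 0.
  by apply/eqP; rewrite -pair_eqE /= h1 h2 !eqxx.
by rewrite -[x]hsubmxK hl hr row_mx0.
Qed.

Lemma independent_le (V : normedModType R) k m (b0 : 'I_k -> V) (b : 'I_m -> V) :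
  (forall i, exists a : 'I_k -> R, b i = \sum_j a j *: b0 j) ->
  (forall a : 'I_m -> R, \sum_i a i *: b i = 0 -> forall i, a i = 0) -> (m <= k)%N.
Proof.
move=> /choice[A AP] ind.
have : row_free (\matrix_(i, j) A i j).
  apply/inj_row_free => x xA; apply/rowP => i; rewrite mxE.
  apply: (ind (fun i => x 0 i)); under eq_bigr do rewrite AP scaler_sumr.
  rewrite exchange_big big1// => j _.
  move/rowP: xA => /(_ j); rewrite !mxE => h.
  under eq_bigr do rewrite scalerA; rewrite -scaler_suml.
  have -> : \sum_i x 0 i * A i j = 0 by rewrite -[RHS]h; apply: eq_bigr => l _; rewrite mxE.
  by rewrite scale0r.
by rewrite /row_free => /eqP <-; exact: rank_leq_col.
Qed.

End LinearAlgebra.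

Section Grassmann.
Context {R : realType} {V : normedModType R}.

Definition fcons k (v : V) (b : 'I_k -> V) (i : 'I_k.+1) : V :=
  if unlift ord0 i is Some j then b j else v.

Lemma sum_fcons k v (b : 'I_k -> V) (a : 'I_k.+1 -> R) :
  \sum_i a i *: fcons v b i = a ord0 *: v + \sum_j a (lift ord0 j) *: b j.
Proof.
rewrite big_ord_recl /fcons unlift_none; congr (_ + _).
by apply: eq_bigr => j _; rewrite liftK.
Qed.

Lemma fcons_independent k (c : {linear V -> R}) v (b : 'I_k -> V) :
  c v = 1 -> (forall i, c (b i) = 0) ->
  (forall a : 'I_k -> R, \sum_i a i *: b i = 0 -> forall i, a i = 0) ->
  forall a : 'I_k.+1 -> R, \sum_i a i *: fcons v b i = 0 -> forall i, a i = 0.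
Proof.
move=> cv cb ind a; rewrite sum_fcons => h.
have a0 : a ord0 = 0.
  have := congr1 c h; rewrite linearD linearZ /= cv linear0 linear_sum big1 ?addr0.
    by rewrite [_ *: _]mulr1.
  by move=> j _; rewrite linearZ cb; exact: mulr0.
move: h; rewrite a0 scale0r add0r => /ind h i.
by case: (unliftP ord0 i) => [j ->|->//]; exact: h.
Qed.

Lemma is_basis_closed k (T : set V) (b : 'I_k -> V) s u w :
  is_basis T b -> T u -> T w -> T (s *: u + w).
Proof.
move=> [TE _]; rewrite TE => -[y _ <-] [z _ <-]; exists (fun i => s * y i + z i) => //.
rewrite scaler_sumr -big_split; apply: eq_bigr => i _ /=.
by rewrite scalerDl scalerA.
Qed.

Lemma is_basis_mem k (T : set V) (b : 'I_k -> V) j : is_basis T b -> T (b j).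
Proof.
move=> [-> _]; exists (fun l => (l == j)%:R) => //.
by rewrite (bigD1 j)//= eqxx scale1r big1 ?addr0// => l /negbTE ->; rewrite scale0r.
Qed.

Lemma is_basis_fcons k (c : {linear V -> R}) (T : set V) (b' : 'I_k -> V) v :
  (forall s u w, T u -> T w -> T (s *: u + w)) -> T v -> c v = 1 ->
  is_basis (T `&` [set u | c u = 0]) b' -> is_basis T (fcons v b').
Proof.
move=> Tadd Tv cv b'P; have [TE ind] := b'P.
have b'k j : (T `&` [set u | c u = 0]) (b' j) by exact: is_basis_mem.
split; last by apply: (fcons_independent cv _ ind) => j; case: (b'k j).
apply/seteqP; split => [u Tu|u [y _ <-]].
  have : (T `&` [set u | c u = 0]) (u - c u *: v).
    split; first by rewrite addrC -scaleNr; exact: Tadd.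
    by rewrite /= linearB linearZ /= cv [_ *: _]mulr1 subrr.
  rewrite TE => -[y _ yE].
  exists (fun i => if unlift ord0 i is Some j then y j else c u) => //.
  rewrite sum_fcons unlift_none; under eq_bigr do rewrite liftK.
  by rewrite yE addrC subrK.
rewrite sum_fcons; apply: (Tadd) => //.
elim/big_rec: _ => [|j w _ Tw]; first by rewrite -(subrr v) addrC -scaleN1r; exact: Tadd.
by apply: Tadd => //; case: (b'k j).
Qed.

(** Exchange argument: some [b i0] has a nonzero coefficient in v; it is dropped, and the other
    vectors are projected to the kernel of c along v. *)
Lemma is_basis_kernel k (c : {linear V -> R}) (T : set V) (b : 'I_k.+1 -> V) v :
  is_basis T b -> T v -> c v = 1 ->
  exists b' : 'I_k -> V, is_basis (T `&` [set u | c u = 0]) b'.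
Proof.
move=> [TE ind] Tv cv; have := Tv; rewrite {1}TE => -[a _ av].
have [i0 ai0] : exists i, a i != 0.
  apply: contrapT => /forallNP h; have : c v = 0.
    rewrite -av linear_sum big1// => i _; have /negP := h i.
    by rewrite negbK => /eqP ->; rewrite scale0r linear0.
  by rewrite cv; apply/eqP; rewrite oner_eq0.
pose b1 j := b (lift i0 j).
pose b' j := b1 j - c (b1 j) *: v.
have cb' j : c (b' j) = 0 by rewrite /b' linearB linearZ /= cv [_ *: _]mulr1 subrr.
have sumb (y : 'I_k -> R) : \sum_j y j *: b' j = \sum_j y j *: b1 j - (\sum_j y j * c (b1 j)) *: v.
  rewrite scaler_suml -sumrB; apply: eq_bigr => j _.
  by rewrite scalerBr scalerA.
have ssum (y : 'I_k.+1 -> R) : \sum_i y i *: b i = y i0 *: b i0 + \sum_j y (lift i0 j) *: b1 j.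
  by rewrite (bigD1_ord i0).
have Tlin (y : 'I_k.+1 -> R) : T (\sum_i y i *: b i) by rewrite TE; exists y.
have ind' (y : 'I_k -> R) : \sum_i y i *: b' i = 0 -> forall i, y i = 0.
  rewrite sumb; set Y := \sum_j _ * _ => h.
  (* The relation [h] in terms of b: [b i0] enters only through v, with coefficient [- Y * a i0], so
     Y vanishes, and then every [y j]. *)
  have := ind (fun i => (if unlift i0 i is Some j then y j else 0) - Y * a i).
  have -> : \sum_i ((if unlift i0 i is Some j then y j else 0) - Y * a i) *: b i = 0.
    under eq_bigr do rewrite scalerBl.
    rewrite sumrB -[RHS]h; congr (_ - _).
      by rewrite ssum unlift_none scale0r add0r; apply: eq_bigr => j _; rewrite liftK.
    by rewrite -av scaler_sumr; apply: eq_bigr => i _; rewrite scalerA.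
  move=> /(_ erefl) h2.
  have Y0 : Y = 0.
    have := h2 i0; rewrite unlift_none sub0r => /eqP; rewrite oppr_eq0 mulf_eq0 (negbTE ai0) orbF.
    by move/eqP.
  by move=> i; have := h2 (lift i0 i); rewrite liftK Y0 mul0r subr0.
have bT j : T (b' j).
  have -> : b' j = \sum_i ((i == lift i0 j)%:R - c (b1 j) * a i) *: b i.
    under eq_bigr do rewrite scalerBl.
    rewrite sumrB; congr (_ - _).
      rewrite (bigD1 (lift i0 j))//= eqxx scale1r big1 ?addr0// => i /negbTE ->.
      by rewrite scale0r.
    by rewrite -av scaler_sumr; apply: eq_bigr => i _; rewrite scalerA.
  exact: Tlin.
have Tadd s u w : T u -> T w -> T (s *: u + w) by apply: (is_basis_closed (b := b)); split.
have T0 : T 0 by rewrite -(subrr v) addrC -scaleN1r; exact: Tadd.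
have Tsum (y : 'I_k -> R) : T (\sum_j y j *: b' j).
  by elim/big_rec: _ => // j u _; exact: Tadd.
have kerspan u : T u -> c u = 0 -> exists y : 'I_k -> R, u = \sum_j y j *: b' j.
  rewrite TE => -[y _ yu] cu.
  (* Subtracting w v from u removes [b i0]; since c u = 0, the corrections contained in the [b' j]
     add up to w v again. *)
  pose w := y i0 / a i0; pose z j := y (lift i0 j) - w * a (lift i0 j).
  have uE : u = w *: v + \sum_j z j *: b1 j.
    rewrite -av -yu !ssum scalerDr -[RHS]addrA; congr (_ + _).
      by rewrite scalerA /w divfK.
    rewrite scaler_sumr -big_split; apply: eq_bigr => j _ /=.
    by rewrite scalerA -scalerDl addrC subrK.
  have cz : \sum_j z j * c (b1 j) = - w.
    apply/eqP; rewrite -addr_eq0 addrC -[X in _ == X]cu uE linearD linearZ /= cv.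
    rewrite [_ *: 1]mulr1 linear_sum; apply/eqP; congr (_ + _).
    by apply: eq_bigr => j _; rewrite linearZ.
  by exists z; rewrite sumb cz scaleNr opprK addrC.
exists b'; split => //.
apply/seteqP; split => [u [Tu cu]|u [y _ <-]].
  by have [y ->] := kerspan u Tu cu; exists y.
split; first exact: Tsum.
by rewrite /= linear_sum big1// => j _; rewrite linearZ cb'; exact: mulr0.
Qed.

Lemma finite_subsequence (T : Type) (u : nat -> T) : finite_set (range u) ->
  exists x (s : nat -> nat), s @ \oo --> \oo /\ forall n, u (s n) = x.
Proof.
move=> /finite_range_cst_subsequence[x [A Aoo Ax]].
have /= [|s [sincr _ As]] := infinite_increasing_seq_wf _ Aoo 0%N.
  by move=> n; apply: sub_finite_set (finite_II n.+1) => m /=.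
exists x, s; split; first exact: increasing_seq_cvgny.
by move=> n; apply/Ax.
Qed.

(* Basis vectors are chosen one at a time, each with a pivot coordinate equal to 1
   and of maximal modulus at which the later ones vanish: the frames are bounded
   and independence survives in the limit. *)
Lemma grass_subsequence k (T : nat -> set V) : fin_dim V ->
  (forall n, exists b : 'I_k -> V, is_basis (T n) b) ->
  exists (s : nat -> nat) (b : nat -> 'I_k -> V) (b0 : 'I_k -> V),
    [/\ s @ \oo --> \oo, forall n, is_basis (T (s n)) (b n),
      forall a : 'I_k -> R, \sum_i a i *: b0 i = 0 -> forall i, a i = 0 &
      forall i, b n i @[n --> \oo] --> b0 i].
Proof.
move=> fV; have [I [e [c [cc cE]]]] := fV.
elim: k T => [|k IH] T hT.
  have [b bP] := choice hT; exists id, b, (fun=> 0).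
  by split => [|||[]//]; [exact: cvg_id| |move=> a _ []].
pose B := \sum_i `|e i|.
have step1 n : exists vi : V * I, [/\ T n vi.1, c vi.2 vi.1 = 1 & `|vi.1| <= B].
  have [b [TE ind]] := hT n; pose v := b ord0.
  have v0 : v != 0.
    apply/eqP => v0; have := ind (fun i => (i == ord0)%:R).
    rewrite (bigD1 ord0)//= -/v v0 scaler0 add0r big1 => [/(_ erefl ord0)|].
      by rewrite eqxx => /eqP; rewrite oner_eq0.
    by move=> i /negbTE ->; rewrite scale0r.
  have [i1 ci1] : exists i, c i v != 0.
    apply: contrapT => /forallNP h; move/eqP: v0; apply; rewrite (cE v) big1// => i _.
    by have /negP := h i; rewrite negbK => /eqP ->; rewrite scale0r.
  (* With a pivot of maximal modulus the normalised vector has all its coordinates bounded by 1,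
     hence the bound B, uniform in n. *)
  have [i _ imax] := @arg_maxP _ R I i1 xpredT (fun i => `|c i v|) isT.
  have ci : c i v != 0.
    by rewrite -normr_gt0; apply: lt_le_trans (imax i1 isT); rewrite normr_gt0.
  exists ((c i v)^-1 *: v, i); split => /=.
  - rewrite TE; exists (fun j => if j == ord0 then (c i v)^-1 else 0) => //.
    rewrite (bigD1 ord0)//= big1 ?addr0// => j /negbTE ->.
    by rewrite scale0r.
  - by rewrite linearZ /= [_ *: _]mulVf.
  - rewrite {2}(cE v) scaler_sumr; apply: (le_trans (ler_norm_sum _ _ _)).
    apply: ler_sum => j _; rewrite !normrZ mulrA ler_piMl// normfV mulrC ler_pdivrMr ?normr_gt0//.
    by rewrite mul1r; exact: imax.
have [vi viP] := choice step1.
have [i [s1 [s1oo s1i]]] : exists i (s : nat -> nat), s @ \oo --> \oo /\ forall n, (vi (s n)).2 = i.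
  by exact: (finite_subsequence (u := fun n => (vi n).2) finite_finset).
have [s2 s2oo /cvg_ex[/= v0 vv0]] : exists2 s : nat -> nat, s @ \oo --> \oo &
    cvgn ((fun n => (vi (s1 n)).1) \o s).
  by apply: (fin_dim_subsequence (B := B)) => // n; case: (viP (s1 n)).
pose v n := (vi (s1 (s2 n))).1.
have vT n : T (s1 (s2 n)) (v n) by case: (viP (s1 (s2 n))).
have cv n : c i (v n) = 1 by rewrite -(s1i (s2 n)); case: (viP (s1 (s2 n))).
have [|s3 [b' [b0' [s3oo b'P b0'ind b'cv]]]] := IH (fun n => T (s1 (s2 n)) `&` [set u | c i u = 0]).
  move=> n; have [b bP] := hT (s1 (s2 n)).
  exact: is_basis_kernel bP (vT n) (cv n).
exists (s1 \o s2 \o s3), (fun n => fcons (v (s3 n)) (b' n)), (fcons v0 b0'); split.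
- by apply: cvg_comp s3oo _; exact: cvg_comp s2oo s1oo.
- move=> n /=; have [bk bP] := hT (s1 (s2 (s3 n))).
  by apply: (is_basis_fcons _ (vT _) (cv _) (b'P n)) => r u w; exact: (is_basis_closed _ bP).
- have cvc (u : nat -> V) u0 r : u @ \oo --> u0 -> (forall n, c i (u n) = r) -> c i u0 = r.
    move=> uu0 ur; have h : c i (u n) @[n --> \oo] --> c i u0.
      by apply: (cvg_comp _ _ uu0); exact: cc.
    apply: (cvg_unique _ h) => //; rewrite (_ : (fun n => c i (u n)) = fun=> r).
      exact: cvg_cst.
    exact/funext.
  apply: (fcons_independent (c := c i)) => //; first exact: cvc vv0 cv.
  move=> j; apply: (cvc _ _ _ (b'cv j)) => n.
  by have [] := is_basis_mem j (b'P n).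
- move=> j; rewrite /fcons; case: (unliftP ord0 j) => [l _|_]; first exact: b'cv.
  exact: cvg_comp s3oo vv0.
Qed.
End Grassmann.

(** * Tangent spaces of submanifolds *)

Section Tangent.
Context {R : realType} {V : normedModType R}.
Hypothesis fV : fin_dim V.

Lemma diff_idE (W : normedModType R) (x v : W) : 'd (id : W -> W) x v = v.
Proof. by case: (is_diff_id x) => _ ->. Qed.

Lemma diffeo_onE (W : normedModType R) (U : set V) (phi : V -> W) : diffeo_on U phi ->
  exists psi : W -> V, [/\ smooth_on (phi @` U) psi, forall x, U x -> psi (phi x) = x,
    forall x, U x -> cancel ('d phi x) ('d psi (phi x)) &
    forall x, U x -> cancel ('d psi (phi x)) ('d phi x)].
Proof.
move=> [oU opU sphi [psi [spsi psiK]]]; exists psi; split => // x Ux.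
- have dphi : differentiable phi x by case: (sphi 1) => h _; exact: h.
  have dpsi : differentiable psi (phi x) by case: (spsi 1) => h _; apply: h; exists x.
  have E : \forall y \near x, (psi \o phi) y = id y := open_near oU Ux psiK.
  have [_ h] := near_eq_is_diff E (differentiable_comp dphi dpsi).
  by move=> v; move/(congr1 (fun f => f v)): h; rewrite diff_comp// diff_idE.
- have dphi : differentiable phi x by case: (sphi 1) => h _; exact: h.
  have dpsi : differentiable psi (phi x) by case: (spsi 1) => h _; apply: h; exists x.
  have E : \forall y \near phi x, (phi \o psi) y = id y.
    apply: (@open_near _ _ (phi @` U)) => //.
    by move=> _ [y Uy <-] /=; rewrite psiK.
  have d1 : differentiable phi (psi (phi x)) by rewrite psiK.
  have [_ h] := near_eq_is_diff E (differentiable_comp dpsi d1).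
  by move=> v; move/(congr1 (fun f => f v)): h; rewrite diff_comp// psiK// diff_idE.
Qed.

(** In the chart, a curve of M has second component 0 for all small t, hence so has its velocity;
    conversely a straight line in the slice, pulled back by [psi], is a smooth curve of M with the
    prescribed velocity. *)
Lemma tangent_chart k c (M : set V) p (U : set V) (phi : V -> 'rV[R]_k * 'rV[R]_c) :
  U p -> diffeo_on U phi ->
  phi @` (M `&` U) = phi @` U `&` [set z | [set: 'rV[R]_k] z.1 /\ z.2 = 0] ->
  M p -> tangent M p = [set v | ('d phi p v).2 = 0].
Proof.
move=> Up dU ME Mp; have [oU opU sphi _] := dU.
have [psi [spsi psiK dK dK']] := diffeo_onE dU.
have fW : fin_dim ('rV[R]_k * 'rV[R]_c)%type by apply: fin_dim_prod; exact: fin_dim_mx.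
have dphi x : U x -> differentiable phi x by case: (sphi 1) => h _; exact: h.
have dpsi x : U x -> differentiable psi (phi x).
  by move=> Ux; case: (spsi 1) => h _; apply: h; exists x.
have Mphi x : M x -> U x -> (phi x).2 = 0.
  move=> Mx Ux; have : (phi @` (M `&` U)) (phi x) by exists x.
  by rewrite ME => -[_ []].
have Mpsi z : (phi @` U) z -> z.2 = 0 -> M (psi z).
  move=> Uz z2; have : (phi @` (M `&` U)) z by rewrite ME.
  by move=> [y [My Uy] <-]; rewrite psiK.
apply/seteqP; split => [v [g [sg g0 gM gv]]|v /= v2].
  have gc : {for 0, continuous g}.
    by have [dg _] := gv; apply: differentiable_continuous; exact/derivable1_diffP.
  have gU : \forall t \near (0 : R), U (g t).
    by apply: gc; rewrite g0; exact: open_nbhs_nbhs.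
  have h1 : is_derive (0 : R) 1 (phi \o g) ('d phi (g 0) v).
    by apply: is_derive_comp_diff => //; rewrite g0; exact: dphi.
  have h2 : is_derive (0 : R) 1 (snd \o (phi \o g)) ('d phi (g 0) v).2.
    have sl : continuous (snd : {linear ('rV[R]_k * 'rV[R]_c)%type -> 'rV[R]_c}).
      by move=> x; exact: cvg_snd.
    have := is_derive_comp_diff h1 (@linear_differentiable _ _ _ _ ((phi \o g) 0) sl).
    by rewrite diff_lin.
  have h3 : \forall t \near (0 : R), 0 = (snd \o (phi \o g)) t.
    by near=> t; rewrite /= Mphi//; near: t.
  have h4 : is_derive (0 : R) 1 (snd \o (phi \o g)) 0.
    by apply: (near_eq_is_derive h3); exact: is_derive_cst.
  have [_ e2] := h2; have [_ e4] := h4.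
  by rewrite g0 e4 in e2; exact: esym e2.
pose w := 'd phi p v; pose l := fun t : R => phi p + t *: w.
have ls j : Ck j [set: R] l.
  apply: (Ck_add openT); first exact: Ck_cst.
  by apply: (Ck_scalel openT); exact: Ck_id.
have l0 : l 0 = phi p by rewrite /l scale0r addr0.
have ol : open (l @^-1` (phi @` U)).
  by apply: open_comp => // t _; apply: (ls 0%N).
have l0U : (phi @` U) (l 0) by rewrite l0; exists p.
have lU : \forall t \near (0 : R), (phi @` U) (l t) by exact: open_nbhs_nbhs.
exists (psi \o l); split => /=.
- exists (l @^-1` (phi @` U)); split => // j.
  by apply: (Ck_comp ol opU fW fV _ (spsi j)) => //; exact: Ck_sub (ls j).
- by rewrite l0 psiK.
- near=> t; apply: Mpsi; first by near: t.
  by rewrite /l /= Mphi// v2 scaler0 addr0.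
- have := is_derive_line (phi p) w 0; rewrite -/l => h.
  have : is_derive (0 : R) 1 (psi \o l) ('d psi (l 0) w).
    by apply: is_derive_comp_diff => //; rewrite l0; exact: dpsi.
  by rewrite l0 dK.
Unshelve. all: by end_near. Qed.

Lemma tangent_submanifold k c (M : set V) p : @submanifold _ V k c M -> M p ->
  exists (L : {linear V -> ('rV[R]_k * 'rV[R]_c)%type})
    (L' : {linear ('rV[R]_k * 'rV[R]_c)%type -> V}),
    [/\ cancel L L', cancel L' L & tangent M p = [set v | (L v).2 = 0]].
Proof.
move=> sM Mp; have [U [phi [Up dU _ ME]]] := sM p Mp.
have [psi [_ _ dK dK']] := diffeo_onE dU.
exists ('d phi p), ('d psi (phi p)); split; [exact: dK|exact: dK'|].
exact: tangent_chart ME Mp.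
Qed.

(** Both sums are the dimension of V, compared through chart differentials at two unrelated points.
    This turns a growth of dimension into a drop of codimension. *)
Lemma submanifold_dim k c k' c' (M M' : set V) p p' : M p -> M' p' ->
  @submanifold _ V k c M -> @submanifold _ V k' c' M' -> (k + c = k' + c')%N.
Proof.
suff H k1 c1 k2 c2 (M1 M2 : set V) p1 p2 : M1 p1 -> M2 p2 -> @submanifold _ V k1 c1 M1 ->
    @submanifold _ V k2 c2 M2 -> (k1 + c1 <= k2 + c2)%N.
  move=> Mp Mp' sM sM'; apply/eqP; rewrite eqn_leq (H _ _ _ _ _ _ _ _ Mp Mp')//.
  by rewrite (H _ _ _ _ _ _ _ _ Mp' Mp).
move=> h1 h2 s1 s2.
have [L1 [L1' [_ K1 _]]] := tangent_submanifold s1 h1.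
have [L2 [L2' [K2 _ _]]] := tangent_submanifold s2 h2.
apply: (linear_rV_prod_inj_le (f := L2 \o L1')) => x /= h.
by rewrite -[x]K1 -[L1' x]K2 h !linear0.
Qed.

Lemma tangent_basis k c (M : set V) p : @submanifold _ V k c M -> M p ->
  exists b : 'I_k -> V, is_basis (tangent M p) b.
Proof.
move=> sM Mp; have [L [L' [K K' ->]]] := tangent_submanifold sM Mp.
exists (fun i => L' (delta_mx 0 i, 0)).
have sumE (a : 'I_k -> R) : \sum_i a i *: L' (delta_mx 0 i, 0) = L' (\row_i a i, 0).
  have -> : (\row_i a i, 0) = \sum_i a i *: (delta_mx 0 i, 0) :> 'rV[R]_k * 'rV[R]_c.
    rewrite [X in (X, _)]row_sum_delta; under eq_bigr do rewrite mxE.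
    elim/big_rec2: _ => // i x y _ <-.
    by congr pair; rewrite /= scaler0 addr0.
  by rewrite linear_sum; apply: eq_bigr => i _; rewrite linearZ.
split.
  apply/seteqP; split => [v /= v2|_ [a _ <-]]; last by rewrite sumE /= K'.
  exists (fun i => (L v).1 0 i) => //; rewrite sumE -[RHS]K; congr (L' _).
  by rewrite [RHS]surjective_pairing v2; congr pair; apply/rowP => i; rewrite mxE.
move=> a; rewrite sumE => /(congr1 L); rewrite K' linear0 => -[/rowP h] i.
by have := h i; rewrite !mxE.
Qed.

End Tangent.

(** * Limits of tangent planes under condition (b) *)

Section Whitney.
Context {R : realType} {V : normedModType R}.
Hypothesis fV : fin_dim V.

(** Condition (b) as it is applied: the secant direction is known through a rescaling by nonzero
    factors that has a limit q <> 0, and y lies in N only eventually, as for points obtained from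
    curves and charts. *)
Lemma whitney_secant (M N : set V) p k (x y : nat -> V) (b : nat -> 'I_k -> V) (b0 : 'I_k -> V)
    (t : nat -> R) (q : V) :
  whitney_b M N p -> (forall z, M z -> ~ N z) -> (forall n, M (x n)) ->
  (\forall n \near \oo, N (y n)) -> x @ \oo --> p -> y @ \oo --> p ->
  (forall n, is_basis (tangent M (x n)) (b n)) ->
  (forall a : 'I_k -> R, \sum_i a i *: b0 i = 0 -> forall i, a i = 0) ->
  (forall i, b n i @[n --> \oo] --> b0 i) ->
  (\forall n \near \oo, t n != 0) -> t n *: (x n - y n) @[n --> \oo] --> q -> q != 0 ->
  exists a : 'I_k -> R, q = \sum_i a i *: b0 i.
Proof.
move=> wb MN Mx Ny xp yp bT b0i bb0 t0 tq q0.
have [m _ mP] : \forall n \near \oo, N (y n) /\ t n != 0 by exact: filterI.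
(* [whitney_b] asks for membership at every n, so the first m terms are discarded. *)
pose s n := (n + m)%N.
have soo : s @ \oo --> \oo by exact: cvg_addnr.
have sP n : N (y (s n)) /\ t (s n) != 0 by apply: mP; exact: leq_addl.
have cs (W : topologicalType) (u : nat -> W) (l : W) : u @ \oo --> l -> u (s n) @[n --> \oo] --> l.
  by move=> ul; exact: cvg_comp soo ul.
have xy n : x (s n) <> y (s n).
  by move=> e; apply: (MN (x (s n))) => //; rewrite e; case: (sP n).
pose tau : set V := [set \sum_i a i *: b0 i | a in [set: 'I_k -> R]].
have : line q `<=` tau.
  apply: (wb (x \o s) (y \o s)) => //=.
  - by move=> n; case: (sP n).
  - exact: cs.
  - exact: cs.
  - exists 1%N, (fun n _ => t (s n) *: (x (s n) - y (s n))), (fun=> q); split.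
    + move=> n; have [_ tn] := sP n; split; last first.
        move=> a; rewrite big_ord1 scalerA => /eqP; rewrite scaler_eq0 mulf_eq0 (negbTE tn) orbF.
        rewrite subr_eq0 => /orP[/eqP a0 i|/eqP/xy//].
        by rewrite ord1.
      apply/seteqP; split => [_ [r _ <-]|_ [a _ <-]].
        by exists (fun=> r / t (s n)) => //; rewrite big_ord1 scalerA divfK.
      by exists (a ord0 * t (s n)) => //; rewrite big_ord1 scalerA.
    + split; last first.
        move=> a; rewrite big_ord1 => /eqP; rewrite scaler_eq0 (negbTE q0) orbF => /eqP a0 i.
        by rewrite ord1.
      apply/seteqP; split => [_ [r _ <-]|_ [a _ <-]].
        by exists (fun=> r) => //; rewrite big_ord1.
      by exists (a ord0) => //; rewrite big_ord1.
    + by move=> _; exact: (cs _ (fun n => t n *: (x n - y n))).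
  - exists k, (fun n => b (s n)), b0; split => // i.
    exact: (cs _ (fun n => b n i)).
move=> /(_ q)[]; first by exists 1 => //; rewrite scale1r.
by move=> a _ <-; exists a.
Qed.

(* With x_n -> p, secants from x_n to gamma(sqrt |x_n - p|) converge to the
   velocity of a curve gamma of N, and secants from x_n to its projection on N in
   a chart accumulate at a direction not tangent to N.  By (b), both directions
   lie in the limit of the planes T_{x_n} M. *)
Lemma whitney_limit (M N : set V) p k c k' c' (x : nat -> V) :
  @submanifold _ V k' c' M -> @submanifold _ V k c N -> N p -> whitney_b M N p ->
  (forall z, M z -> ~ N z) -> (forall n, M (x n)) -> x @ \oo --> p ->
  (k < k')%N /\
  exists (s : nat -> nat) (b : nat -> 'I_k' -> V) (b0 : 'I_k' -> V),
    [/\ s @ \oo --> \oo, forall n, is_basis (tangent M (x (s n))) (b n),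
      forall i, b n i @[n --> \oo] --> b0 i &
      forall v, tangent N p v -> exists a : 'I_k' -> R, v = \sum_i a i *: b0 i].
Proof.
move=> sM sN Np wb MN Mx xp.
have [s [b [b0 [soo bP b0i bb0]]]] := grass_subsequence fV (fun n => tangent_basis fV sM (Mx n)).
pose x1 n := x (s n).
have x1p : x1 @ \oo --> p by exact: cvg_comp soo xp.
have x1n n : x1 n != p by apply/eqP => e; apply: (MN (x1 n)); [exact: Mx|rewrite e].
have x1p0 n : x1 n - p != 0 by rewrite subr_eq0.
have tN v : tangent N p v -> exists a : 'I_k' -> R, v = \sum_i a i *: b0 i.
  have [-> _|v0] := eqVneq v 0.
    by exists (fun=> 0); rewrite big1// => i _; rewrite scale0r.
  move=> [g [_ g0 gN [gd gv]]].
  (* The square root makes x_n - p negligible against the displacement along the curve: |x_n - p| /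
     r_n = r_n tends to 0. *)
  pose r n := Num.sqrt `|x1 n - p|.
  have r0 n : r n != 0 by rewrite gt_eqF// sqrtr_gt0 normr_gt0.
  have roo : r @ \oo --> 0.
    have h1 : x1 n - p @[n --> \oo] --> 0 by rewrite -(subrr p); apply: cvgB => //; exact: cvg_cst.
    have := cvg_comp _ _ (cvg_norm h1) (@sqrt_continuous R _).
    by rewrite normr0 sqrtr0 => h; exact: h.
  have gc : {for 0, continuous g}.
    by apply: differentiable_continuous; exact/derivable1_diffP.
  apply: (whitney_secant (x := x1) (y := g \o r) (t := fun n => - (r n)^-1) wb MN)
    bP b0i bb0 _ _ v0.
  - by move=> n; exact: Mx.
  - exact: (roo _ gN).
  - exact: x1p.
  - by rewrite -g0; exact: cvg_comp roo gc.
  - by apply: nearW => n; rewrite oppr_eq0 invr_eq0.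
  - have -> : (fun n => - (r n)^-1 *: (x1 n - (g \o r) n)) =
        (fun n => (r n)^-1 *: (g (r n *: 1 + 0) - g 0) - (r n)^-1 *: (x1 n - p)).
      apply/funext => n; rewrite /= [_ *: 1]mulr1 addr0 g0 -scalerBr scaleNr -scalerN.
      by congr (_ *: _); rewrite !opprB addrA subrK.
    rewrite -[v]subr0; apply: cvgB.
      have rd : r @ \oo --> 0^'.
        move=> A hA; have h : \forall n \near \oo, (r n != 0 -> A (r n)) by exact: (roo _ hA).
        by apply: (filterS _ h : \forall n \near \oo, A (r n)) => n; apply.
      by rewrite -gv; exact: (cvg_comp _ _ rd gd).
    apply/norm_cvg0P; rewrite (_ : (fun n => _) = r)//; apply/funext => n /=.
    rewrite normrZ normfV ger0_norm ?sqrtr_ge0//.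
    by rewrite -[X in _ * X]sqr_sqrtr// -/(r n) expr2 mulKf.
split; last by exists s, b, b0.
have [U [phi [Up dU phip NE]]] := sN p Np.
have [psi [spsi psiK dK dK']] := diffeo_onE dU.
have [oU opU sphi _] := dU.
have fW : fin_dim ('rV[R]_k * 'rV[R]_c)%type by apply: fin_dim_prod; exact: fin_dim_mx.
have Npsi z : (phi @` U) z -> z.2 = 0 -> N (psi z).
  move=> Uz z2; have : (phi @` (N `&` U)) z by rewrite NE.
  by move=> [y [My Uy] <-]; rewrite psiK.
have opp : (phi @` U) (phi p) by exists p.
pose z n : 'rV[R]_k * 'rV[R]_c := ((phi (x1 n)).1, 0).
pose y n := psi (z n).
have phix : phi (x1 n) @[n --> \oo] --> phi p.
  by apply: (cvg_comp _ _ x1p); exact: (Ck_continuous (sphi 0%N) Up).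
have zp : z n @[n --> \oo] --> phi p.
  have h1 : (phi (x1 n)).1 @[n --> \oo] --> (0 : 'rV[R]_k).
    by rewrite -[0]/(0 : 'rV[R]_k * 'rV[R]_c).1 -phip; exact: (cvg_comp _ _ phix cvg_fst).
  rewrite phip; exact: (cvg_pair (F := \oo) (G := nbhs (0 : 'rV[R]_k))
    (H := nbhs (0 : 'rV[R]_c)) h1 (cvg_cst (0 : 'rV[R]_c))).
have zU : \forall n \near \oo, (phi @` U) (z n) by apply: zp; exact: open_nbhs_nbhs.
have xU : \forall n \near \oo, U (x1 n) by apply: x1p; exact: open_nbhs_nbhs.
have yp : y n @[n --> \oo] --> p.
  rewrite -[X in _ --> X](psiK p Up); apply: (cvg_comp _ _ zp).
  exact: (Ck_continuous (spsi 0%N) opp).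
have yN : \forall n \near \oo, N (y n) by apply: filterS zU => n zn; exact: Npsi.
have phiy : \forall n \near \oo, phi (y n) = z n.
  by apply: filterS zU => n [w Uw wz]; rewrite /y -wz psiK.
have xy : \forall n \near \oo, x1 n - y n != 0.
  apply: filterS yN => n yn; rewrite subr_eq0; apply/eqP => e.
  by apply: (MN (x1 n)); [exact: Mx|rewrite e].
pose u n := `|x1 n - y n|^-1 *: (x1 n - y n).
have [s2 s2oo /cvg_ex[/= u0 uu0]] : exists2 s : nat -> nat, s @ \oo --> \oo & cvgn (u \o s).
  apply: (fin_dim_subsequence (B := 1)) => // n; rewrite normrZ normfV normr_id.
  by have [->|h] := eqVneq (x1 n - y n) 0; rewrite ?normr0 ?mulr0// mulVf ?normr_eq0.
have xy2 : \forall n \near \oo, x1 (s2 n) - y (s2 n) != 0 by exact: (s2oo _ xy).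
have nu0 : `|u0| = 1.
  have h1 : \forall n \near \oo, `|u (s2 n)| = 1.
    apply: filterS xy2 => n h.
    by rewrite normrZ normfV normr_id mulVf ?normr_eq0.
  apply: (cvg_unique _ (cvg_norm uu0)) => //.
  exact: cvg_near_cst.
(* In the chart x1 n and y n have the same first component, so strict differentiability bounds that
   component of ['d phi p (x1 n - y n)] by an arbitrarily small multiple of |x1 n - y n|. *)
have L1 : ('d phi p u0).1 = 0.
  have cL : continuous ('d phi p) by apply: diff_continuous; case: (sphi 1) => h _; exact: h.
  have h1 : ('d phi p (u (s2 n))).1 @[n --> \oo] --> ('d phi p u0).1.
    have h0 : 'd phi p (u (s2 n)) @[n --> \oo] --> 'd phi p u0 by exact: (cvg_comp _ _ uu0 (cL u0)).
    by exact: (cvg_comp _ _ h0 cvg_fst).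
  apply: (cvg_unique _ h1) => //.
  apply/norm_cvg0P/cvgrPdist_le => e e0.
  have [dl dl0 hd] := strict_diff fV fW oU (sphi 1) Up e0.
  have bx : \forall n \near \oo, ball p dl (x1 n) by apply: x1p; exact: nbhsx_ballx.
  have by_ : \forall n \near \oo, ball p dl (y n) by apply: yp; exact: nbhsx_ballx.
  suff h2 : \forall n \near \oo, `|('d phi p (u n)).1| <= e.
    have h3 : \forall n \near \oo, `|('d phi p (u (s2 n))).1| <= e by exact: (s2oo _ h2).
    by apply: filterS h3 => n; rewrite sub0r normrN normr_id.
    near=> n; have xyn : x1 n - y n != 0 by near: n.
    have bxn : ball p dl (x1 n) by near: n.
    have byn : ball p dl (y n) by near: n.
    have := hd (x1 n) (y n) bxn byn; rewrite (_ : phi (y n) = z n); last by near: n.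
    move=> H.
    have {}H : `|('d phi p (x1 n - y n)).1| <= e * `|x1 n - y n|.
      apply: le_trans H; rewrite prod_normE le_max; apply/orP; left.
      by rewrite /= subrr sub0r normrN.
    rewrite /u linearZ /= normrZ normfV normr_id mulrC ler_pdivrMr ?normr_gt0//.
have u00 : u0 != 0 by rewrite -normr_gt0 nu0.
have [a ua] : exists a : 'I_k' -> R, u0 = \sum_i a i *: b0 i.
  apply: (whitney_secant (x := x1 \o s2) (y := y \o s2) (b := fun n => b (s2 n))
    (t := fun n => `|x1 (s2 n) - y (s2 n)|^-1) wb MN) b0i _ _ uu0 u00.
  - by move=> n; exact: Mx.
  - exact: (s2oo _ yN).
  - exact: cvg_comp s2oo x1p.
  - exact: cvg_comp s2oo yp.
  - by move=> n; exact: bP.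
  - by move=> i; exact: (cvg_comp _ _ s2oo (bb0 i)).
  - by apply: filterS xy2 => n h; rewrite invr_eq0 normr_eq0.
have L2 : ('d phi p u0).2 != 0.
  apply/eqP => L2; move/eqP: u00; apply; rewrite -[u0](dK p Up).
  by rewrite [X in 'd psi _ X]surjective_pairing L1 L2 linear0.
have [b1 [b1E b1i]] := tangent_basis fV sN Np.
have b1k j : ('d phi p (b1 j)).2 = 0.
  have : tangent N p (b1 j) by exact: (is_basis_mem j (conj b1E b1i)).
  by rewrite (tangent_chart fV Up dU NE Np).
(* The limit plane, spanned by k' vectors, contains a basis of T_p N and also [u0], which is not
   tangent to N: k + 1 independent vectors. *)
apply: (independent_le (b0 := b0) (b := fcons u0 b1)).
  move=> j; rewrite /fcons; case: (unliftP ord0 j) => [l _|_]; last by exists a.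
  by apply: tN; exact: (is_basis_mem l (conj b1E b1i)).
move=> e; rewrite sum_fcons => he.
have e0 : e ord0 = 0.
  have := congr1 (fun v => ('d phi p v).2) he.
  rewrite linearD linearZ linear_sum linear0 /= raddf_sum big1 => [|j _]; last first.
    by rewrite linearZ /= b1k scaler0.
  by rewrite addr0 => /eqP; rewrite scaler_eq0 (negbTE L2) orbF => /eqP.
move: he; rewrite e0 scale0r add0r => /b1i h j.
by case: (unliftP ord0 j) => [l ->|->//]; exact: h.
Unshelve. all: by end_near. Qed.

End Whitney.

(** * Strata accumulating at a point *)

Section Stratified.
Context {R : realType} {V : normedModType R}.
Hypothesis fV : fin_dim V.

Lemma near_or_sequence (Q : set V) (p : V) :
  (\forall z \near p, Q z) \/ exists x : nat -> V, x @ \oo --> p /\ forall n, ~ Q (x n).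
Proof.
have [?|nQ] := pselect (\forall z \near p, Q z); [by left|right].
have /choice[x xP] : forall n : nat, exists z, ball p n.+1%:R^-1 z /\ ~ Q z.
  move=> n; apply: contrapT => /forallNP h; apply: nQ.
  apply/nbhs_ballP; exists n.+1%:R^-1 => [|z /= pz]; first by rewrite /= invr_gt0.
  by apply: contrapT => Qz; exact: (h z).
exists x; split => [|n]; last by case: (xP n).
apply/cvgrPdist_lt => e e0; near=> n.
have [+ _] := xP n; rewrite -ball_normE /= => /lt_trans; apply.
by near: n; exact: near_infty_natSinv_lt (PosNum e0).
Unshelve. all: by end_near. Qed.

(** Local finiteness at p and the pigeonhole principle. *)
Lemma strat_subsequence (X : set V) S (p : V) (x : nat -> V) :
  stratification X S -> X p -> (forall n, X (x n)) -> x @ \oo --> p ->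
  exists M (s : nat -> nat), [/\ S M, s @ \oo --> \oo & forall n, M (x (s n))].
Proof.
move=> [XE _ _ lf] Xp Xx xp; have [U [oU fU]] := lf p Xp.
have [m _ mP] : \forall n \near \oo, U (x n) by apply: xp; exact: open_nbhs_nbhs.
have /choice[M MP] : forall n, exists M, S M /\ M (x n).
  by move=> n; have := Xx n; rewrite XE => -[M SM Mx]; exists M.
have [|M0 [s [soo sP]]] := @finite_subsequence _ (fun n => M (n + m)%N).
  apply: sub_finite_set fU => _ [n _ <-]; have [SM Mx] := MP (n + m)%N.
  by split => //; exists (x (n + m)%N); split => //; apply: mP; exact: leq_addl.
exists M0, (fun n => s n + m)%N; split.
- by rewrite -(sP 0%N); case: (MP (s 0 + m)%N).
- exact: (cvg_comp _ _ soo (cvg_addnr m)).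
- by move=> n; rewrite -(sP n); case: (MP (s n + m)%N).
Qed.

(** Tangent vectors of N are constant in the chart: v is carried from p to the points of the
    sequence by ['d phi p] followed by the differential of [psi] there. *)
Lemma tangent_limit_self k c (N : set V) (p : V) (x : nat -> V) v :
  @submanifold _ V k c N -> N p -> (forall n, N (x n)) -> x @ \oo --> p -> tangent N p v ->
  exists (s : nat -> nat) (w : nat -> V),
    [/\ s @ \oo --> \oo, w @ \oo --> v & forall n, tangent N (x (s n)) (w n)].
Proof.
move=> sN Np Nx xp Tv; have [U [phi [Up dU _ NE]]] := sN p Np.
have [psi [spsi psiK dK dK']] := diffeo_onE dU; have [oU opU sphi _] := dU.
have [m _ mP] : \forall n \near \oo, U (x n) by apply: xp; exact: open_nbhs_nbhs.
have soo : (addn^~ m) @ \oo --> \oo by exact: cvg_addnr.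
have Ux n : U (x (n + m)%N) by apply: mP; exact: leq_addl.
exists (addn^~ m), (fun n => 'd psi (phi (x (n + m)%N)) ('d phi p v)); split => //.
  rewrite -[X in _ --> X](dK p Up).
  have [_ /(_ ('d phi p v) (phi p) (imageP _ Up)) h] := spsi 1.
  have xs : x (n + m)%N @[n --> \oo] --> p by exact: cvg_comp soo xp.
  have := cvg_comp _ _ xs (Ck_continuous (sphi 0%N) Up) => phis.
  by exact: (cvg_comp _ _ phis h).
move=> n; rewrite (tangent_chart fV (Ux n) dU NE (Nx _)) /= dK' //.
by move: Tv; rewrite (tangent_chart fV Up dU NE Np).
Qed.

Lemma strat_higher (X : set V) S M N (p : V) k c k' c' (x : nat -> V) :
  whitney_stratification X S ->
  S M -> S N -> M <> N -> N p -> (forall n, M (x n)) -> x @ \oo --> p ->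
  @submanifold _ V k c N -> @submanifold _ V k' c' M -> (c' < c)%N.
Proof.
move=> [[_ _ dis _] wb] SM SN MN Np Mx xp sN sM.
have [|kk' _] := whitney_limit fV sM sN Np (wb M N SM SN MN p Np) _ Mx xp.
  by move=> z Mz Nz; apply: MN; apply: dis => //; exists z.
by have := submanifold_dim fV Np (Mx 0%N) sN sM; rewrite -(ltn_add2l k) => ->; rewrite ltn_add2r.
Qed.

(** Whitney's condition (a) in sequential form, obtained here from (b); the sequence may run in
    other strata or in N itself. *)
Lemma tangent_limit (X : set V) S N (p : V) (x : nat -> V) v : whitney_stratification X S ->
  S N -> N p -> (forall n, X (x n)) -> x @ \oo --> p -> tangent N p v ->
  exists M (s : nat -> nat) (w : nat -> V),
    [/\ S M, s @ \oo --> \oo, w @ \oo --> v & forall n, M (x (s n)) /\ tangent M (x (s n)) (w n)].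
Proof.
move=> ws SN Np Xx xp Tv; have [st wb] := ws; have [XE sub dis _] := st.
have Xp : X p by rewrite XE; exists N.
have [M [s [SM soo sM]]] := strat_subsequence st Xp Xx xp.
have xsp : x \o s @ \oo --> p by exact: cvg_comp soo xp.
have [_ [k' [c' subM]]] := sub M SM; have [_ [k [c subN]]] := sub N SN.
have [MN|MN] := pselect (M = N).
  have sN : forall n, N ((x \o s) n) by rewrite -MN.
  have [s' [w [s'oo wv wT]]] := tangent_limit_self subN Np sN xsp Tv.
  exists M, (s \o s'), w; split => //; first exact: cvg_comp s'oo soo.
  by move=> n; rewrite MN; split; [exact: sN|exact: wT].
have [|_ [s' [b [b0 [s'oo bT bb0 h]]]]] :=
    whitney_limit fV subM subN Np (wb M N SM SN MN p Np) _ sM xsp.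
  by move=> z Mz Nz; apply: MN; apply: dis => //; exists z.
have [a va] := h v Tv.
exists M, (s \o s'), (fun n => \sum_i a i *: b n i); split => //.
- exact: cvg_comp s'oo soo.
- rewrite va; apply: (@cvg_big V _ +%R 0 xpredT); first exact: add_continuous.
  by move=> i _; apply: cvgZl_tmp; exact: bb0.
- move=> n; split; first exact: sM.
  by have [-> _] := bT n; exists a.
Qed.

End Stratified.

(** * The stratified set of jets *)

(** Rank at most 1 allows a factorisation through a single column, which makes the 2 x 2 minors
    vanish; conversely both columns are multiples of b if a = 0, and of a otherwise. *)
Lemma rank_row_mx_le1 (F : fieldType) d (a b : 'rV[F]_d) :
  (\rank (row_mx a^T b^T) <= 1)%N <-> forall i j, a 0 i * b 0 j = a 0 j * b 0 i.
Proof.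
split => [h i j|h].
  have [C [D CD]] : exists (C : 'cV[F]_d) (D : 'rV[F]_(1 + 1)), row_mx a^T b^T = C *m D.
    move: (mulmx_base (row_mx a^T b^T)).
    move: (col_base _) (row_base _) h; case: (\rank _) => [|[|//]] C D _ <-.
      by exists 0, 0; rewrite mul0mx; apply/matrixP => p q; rewrite !mxE big_ord0.
    by exists C, D.
  have aE l : a 0 l = C l 0 * D 0 (lshift 1 0).
    move/matrixP : CD => /(_ l (lshift 1 0)); rewrite row_mxEl !mxE => ->.
    by rewrite big_ord1.
  have bE l : b 0 l = C l 0 * D 0 (rshift 1 0).
    move/matrixP : CD => /(_ l (rshift 1 0)); rewrite row_mxEr !mxE => ->.
    by rewrite big_ord1.
  by rewrite !aE !bE; ring.
have [a0|[i ai]] : (forall i, a 0 i = 0) \/ exists i, a 0 i != 0.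
  have [?|/existsNP[i /eqP ai]] := pselect (forall i, a 0 i = 0); [by left|by right; exists i].
  suff -> : row_mx a^T b^T = b^T *m row_mx 0 1%:M.
    by apply: (leq_trans (mxrankM_maxl _ _)); exact: rank_leq_col.
  by rewrite mul_mx_row mulmx0 mulmx1; congr row_mx; apply/matrixP => p q; rewrite !mxE ord1.
suff -> : row_mx a^T b^T = a^T *m row_mx 1%:M (b 0 i / a 0 i)%:M.
  by apply: (leq_trans (mxrankM_maxl _ _)); exact: rank_leq_col.
rewrite mul_mx_row mulmx1 mul_mx_scalar; congr row_mx; apply/matrixP => p q; rewrite !mxE !ord1.
by apply: (mulfI ai); rewrite h; field; exact: ai.
Qed.

Section Jets.
Context {R : realType} {d : nat}.
Local Notation J := (J1 R d).
Implicit Types (z : J).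

Lemma fin_dim_jet : fin_dim J.
Proof. by do 2 (apply: fin_dim_prod; last exact: fin_dim_mx); exact: fin_dim_mx. Qed.

(** The last component of [u_map]: the gradient of f when z is the 1-jet of H. *)
Definition grad z (i : 'I_d) : R :=
  2 * z.1.2 0 i * z.1.1 0 i + \sum_j z.2 j i * z.1.1 0 j ^+ 2.

(** The differential of [grad] at z applied to v, as [is_derive_grad] confirms. *)
Definition dgrad z (v : J) (i : 'I_d) : R :=
  2 * (v.1.2 0 i * z.1.1 0 i + z.1.2 0 i * v.1.1 0 i) +
  \sum_j (v.2 j i * z.1.1 0 j ^+ 2 + z.2 j i * (2 * z.1.1 0 j * v.1.1 0 j)).

Local Notation X := (u_map @^-1` (@Z R d)).

Lemma preimage_ZP z : X z <-> forall i j, grad z i * z.1.1 0 j = grad z j * z.1.1 0 i.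
Proof.
case: z => [[x h] H1]; rewrite /Z /u_map /= rank_row_mx_le1; split => H i j.
  by have := H j i; rewrite !mxE /grad /= mulrC => ->; rewrite mulrC.
by rewrite !mxE mulrC [RHS]mulrC; exact: H.
Qed.

Lemma is_derive_linear (V W : normedModType R) (L : {linear V -> W}) (g : R -> V) (t : R) v :
  continuous L -> is_derive t 1 g v -> is_derive t 1 (L \o g) (L v).
Proof.
move=> cL h; have := is_derive_comp_diff h (@linear_differentiable _ _ _ _ (g t) cL).
by rewrite diff_lin.
Qed.

Lemma is_derive_entry m n (g : R -> 'M[R]_(m, n)) (t : R) v i j :
  is_derive t 1 g v -> is_derive t 1 (fun t => g t i j) (v i j).
Proof.
have cL : continuous (mx_coord i j : {linear 'M[R]_(m, n) -> R}).
  by move=> M; exact: coord_continuous.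
by move=> h; exact: is_derive_linear cL h.
Qed.

Lemma is_derive_fst (V W : normedModType R) (g : R -> (V * W)%type) (t : R) v :
  is_derive t 1 g v -> is_derive t 1 (fun t => (g t).1) v.1.
Proof.
apply: (is_derive_linear (L := fst : {linear (V * W)%type -> V})) => x; exact: cvg_fst.
Qed.

Lemma is_derive_snd (V W : normedModType R) (g : R -> (V * W)%type) (t : R) v :
  is_derive t 1 g v -> is_derive t 1 (fun t => (g t).2) v.2.
Proof.
apply: (is_derive_linear (L := snd : {linear (V * W)%type -> W})) => x; exact: cvg_snd.
Qed.

Lemma is_derive_mulf (V : normedModType R) (f g : V -> R) (x v : V) (a b : R) :
  is_derive x v f a -> is_derive x v g b ->
  is_derive x v (fun t => f t * g t) (a * g x + f x * b).
Proof.
move=> h1 h2; apply: (is_derive_eq (is_deriveM h1 h2)).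
by rewrite /= addrC [g x *: a]mulrC.
Qed.

Lemma is_derive_addf (f g : R -> R) (t a b : R) : is_derive t 1 f a -> is_derive t 1 g b ->
  is_derive t 1 (fun t => f t + g t) (a + b).
Proof. exact: is_deriveD. Qed.

Lemma is_derive_sumf n (f : 'I_n -> R -> R) (t : R) (a : 'I_n -> R) :
  (forall i, is_derive t 1 (f i) (a i)) ->
  is_derive t 1 (fun t => \sum_i f i t) (\sum_i a i).
Proof.
move=> h; rewrite (_ : (fun t => _) = \sum_i f i); first exact: is_derive_sum.
by apply/funext => u; rewrite fct_sumE.
Qed.

Lemma is_derive_cstf (t a : R) : is_derive t 1 (fun=> a) 0.
Proof. exact: is_derive_cst. Qed.

Lemma is_derive_grad (g : R -> J) (t : R) (v : J) i : is_derive t 1 g v ->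
  is_derive t 1 (fun t => grad (g t) i) (dgrad (g t) v i).
Proof.
move=> gv; have g1 := is_derive_fst gv.
have dx k : is_derive t 1 (fun t => (g t).1.1 0 k) (v.1.1 0 k).
  exact: is_derive_entry (is_derive_fst g1).
have dh k : is_derive t 1 (fun t => (g t).1.2 0 k) (v.1.2 0 k).
  exact: is_derive_entry (is_derive_snd g1).
have dH k l : is_derive t 1 (fun t => (g t).2 k l) (v.2 k l).
  exact: is_derive_entry (is_derive_snd gv).
have d1 := is_derive_mulf (is_derive_mulf (is_derive_cstf t 2) (dh i)) (dx i).
have d2 := is_derive_sumf (fun j => is_derive_mulf (dH j i) (is_derive_mulf (dx j) (dx j))).
apply: (is_derive_eq (is_derive_addf d1 d2)).
rewrite /dgrad; congr (_ + _); first by ring.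
by apply: eq_bigr => j _; ring.
Qed.

(** The equation g_i x_j = g_j x_i differentiated along a curve of M. At points with x = 0 it reads
    0 = 0. *)
Lemma tangent_preimage_Z (M : set J) z (v : J) i j : M `<=` X -> tangent M z v ->
  dgrad z v i * z.1.1 0 j + grad z i * v.1.1 0 j = dgrad z v j * z.1.1 0 i + grad z j * v.1.1 0 i.
Proof.
move=> MX [g [_ g0 gM gv]].
have dx k : is_derive (0 : R) 1 (fun t => (g t).1.1 0 k) (v.1.1 0 k).
  exact: is_derive_entry (is_derive_fst (is_derive_fst gv)).
have [_ d1] := is_derive_mulf (is_derive_grad i gv) (dx j).
have [_ d2] := is_derive_mulf (is_derive_grad j gv) (dx i).
rewrite -g0 -d1 -d2; apply: near_eq_derive.
by apply: filterS gM => t /MX/preimage_ZP; apply.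
Qed.

Definition jet_pt (h : 'rV[R]_d) (H1 : 'M[R]_d) : J := (0, h, H1).

Lemma grad_jet_pt h H1 i : grad (jet_pt h H1) i = 0.
Proof.
rewrite /grad /= mxE mulr0 add0r big1// => j _.
by rewrite mxE expr0n mulr0.
Qed.

Lemma preimage_Z_jet_pt h H1 : X (jet_pt h H1).
Proof. by apply/preimage_ZP => i j; rewrite !grad_jet_pt !mul0r. Qed.

Lemma tangent_jet_pt (N : set J) h H1 k K :
  (\forall z \near jet_pt h H1, z.1.1 = 0 -> N z) -> tangent N (jet_pt h H1) (jet_pt k K).
Proof.
move=> nN; pose l (t : R) := jet_pt h H1 + t *: jet_pt k K; exists l.
have sm j : Ck j [set: R] l.
  apply: (Ck_add openT); first exact: Ck_cst.
  by apply: (Ck_scalel openT); exact: Ck_id.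
have l0 : l 0 = jet_pt h H1 by rewrite /l scale0r addr0.
have lE (t : R) : (l t).1.1 = 0 by rewrite /= scaler0 addr0.
have c0 : {for 0, continuous l} := sm 0%N 0 I.
split => //.
- by exists setT; split => //; split => //; exact: openT.
- have nN' : nbhs (l 0) [set z : J | z.1.1 = 0 -> N z] by rewrite l0.
  have hN : \forall t \near (0 : R), (l t).1.1 = 0 -> N (l t) := c0 _ nN'.
  by apply: filterS hN => t; apply.
- exact: is_derive_line.
Qed.

Lemma dgrad_mx z (K : 'M[R]_d) i : dgrad z (0, 0, K) i = \sum_l K l i * z.1.1 0 l ^+ 2.
Proof.
rewrite /dgrad /= !mxE !mul0r mulr0 addr0 mulr0 add0r; apply: eq_bigr => j _.
by rewrite mxE !mulr0 addr0.
Qed.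

(** At a point with x_i <> 0, varying row i of H1 outside column i gives d - 1 directions: the
    variation y_j changes the equation for the pair (i, j) by y_j x_i^3, so no nonzero combination
    is tangent to M. A stratum contained in E has no such point, but its tangent vectors have zero
    x-part and the codimension is at least d. *)
Lemma codim_ge k c (M : set J) z : submanifold k c M -> M `<=` X -> M z ->
  (d.-1 <= c)%N.
Proof.
move=> sM MX.
have [[z0 [Mz0 [i xi]]] _|noz Mz] := pselect (exists z, M z /\ exists i, z.1.1 0 i != 0).
  have [L [L' [K K' TE]]] := tangent_submanifold fin_dim_jet sM Mz0.
  pose mx (y : 'rV[R]_d.-1) : 'M[R]_d :=
    \matrix_(l, m) if l == i then (if unlift i m is Some j then y 0 j else 0) else 0.
  have mxl : linear (fun y => (0, 0, mx y) : J).
    move=> a u v; congr pair; first by congr pair; rewrite /= scaler0 addr0.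
    apply/matrixP => l m; rewrite !mxE; case: eqP => _; last by rewrite mulr0 addr0.
    by case: (unlift i m) => [j|]; rewrite ?mxE// mulr0 addr0.
  pose mxL : {linear 'rV[R]_d.-1 -> J} := HB.pack (fun y => (0, 0, mx y) : J)
     (GRing.isLinear.Build _ _ _ _ _ mxl).
  apply: (linear_rV_inj_le (f := snd \o (L \o mxL))) => y /= Ly.
  apply/rowP => j; rewrite mxE.
  have Ty : tangent M z0 (0, 0, mx y) by rewrite TE.
  have := tangent_preimage_Z i (lift i j) MX Ty; rewrite /= !mxE !mulr0 !addr0 !dgrad_mx.
  rewrite (bigD1 i)//= !mxE eqxx unlift_none mul0r add0r big1; last first.
    by move=> l /negbTE li; rewrite mxE li mul0r.
  rewrite mul0r (bigD1 i)//= !mxE eqxx liftK big1 ?addr0; last first.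
    by move=> l /negbTE li; rewrite mxE li mul0r.
  move=> /esym/eqP; rewrite !mulf_eq0 !(negbTE xi) /= !orbF.
  by move/eqP.
have ME w : M w -> w.1.1 = 0.
  move=> Mw; apply/rowP => i; rewrite mxE; apply/eqP/negP => /negP wi; apply: noz.
  by exists w; split => //; exists i.
have [L [L' [K K' TE]]] := tangent_submanifold fin_dim_jet sM Mz.
apply: leq_trans (leq_pred d) _.
have inl_ : linear (fun y : 'rV[R]_d => (y, 0, 0) : J).
  by move=> a u v; congr pair; rewrite /= ?scaler0 ?addr0//; congr pair; rewrite /= scaler0 addr0.
pose inL : {linear 'rV[R]_d -> J} := HB.pack (fun y => (y, 0, 0) : J)
     (GRing.isLinear.Build _ _ _ _ _ inl_).
apply: (linear_rV_inj_le (f := snd \o (L \o inL))) => y /= Ly.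
have : tangent M z (y, 0, 0) by rewrite TE.
move=> [g [_ g0 gM gv]].
have [_ /= <-] := is_derive_fst (is_derive_fst gv).
rewrite -[RHS](derive_cst (0 : 'rV[R]_d) (0 : R) 1); apply: near_eq_derive.
by apply: filterS gM => t /ME.
Qed.

(** The map [snd \o L] vanishes on the tangent space of M, so transversality makes its composite
    with the differential of [jet1 H] onto, from dimension d to dimension c. *)
Lemma codim_le (H : 'rV[R]_d -> 'rV[R]_d) k c (M : set J) : submanifold k c M ->
  M (jet1 H 0) -> transverse_at (jet1 H) M 0 -> (c <= d)%N.
Proof.
move=> sM Mj tr; have [L [L' [K K' TE]]] := tangent_submanifold fin_dim_jet sM Mj.
apply: (linear_rV_surj_le (f := snd \o (L \o 'd (jet1 H) (0 : 'rV[R]_d)))) => y.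
have [w [t [Tt e]]] := tr Mj (L' (0, y)).
exists w; move: Tt; rewrite TE /= => t0.
have := congr1 (fun v => (L v).2) e; rewrite K' /= linearD /= t0 addr0 => ->.
by [].
Qed.

End Jets.

(** * Curves of X leaving E *)

Section Curve.
Context {R : realType} {d : nat}.
Local Notation J := (J1 R d).
Local Notation X := (u_map @^-1` (@Z R d)).
Variables (h : 'rV[R]_d) (H1 : 'M[R]_d) (a : 'I_d).

(* A curve of X through (0, h, H1): x_j = r if h_j = h_a and x_j = O(r^2)
   otherwise, h and H1 being corrected so that g = 2 h_a x exactly. *)
Definition same_eig (j : 'I_d) := h 0 j == h 0 a.
Definition curve_S (j : 'I_d) := \sum_(l | same_eig l) H1 l j.
(** With x_j = r or r^2 w_j, the sum of the H1_lj x_l^2 is r^2 S_j + r^4 T_j. If h_j <> h_a, the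
    correction in row a of H1 removes r^4 T_j, and 2 h_j x_j + r^2 S_j = 2 h_a x_j gives this w_j.
    If h_j = h_a, solving for h_j instead gives h_a - (r / 2) (S_j + r^2 T_j). *)
Definition curve_w (j : 'I_d) := curve_S j / (2 * (h 0 a - h 0 j)).
Definition curve_T (j : 'I_d) := \sum_(l | ~~ same_eig l) H1 l j * curve_w l ^+ 2.

Definition curve (r : R) : J :=
  (\row_j (if same_eig j then r else r ^+ 2 * curve_w j),
   \row_j (if same_eig j then h 0 a - r / 2 * (curve_S j + r ^+ 2 * curve_T j) else h 0 j),
   \matrix_(l, j) (H1 l j - (if (l == a) && ~~ same_eig j then r ^+ 2 * curve_T j else 0))).

Lemma grad_curve r j : grad (curve r) j = 2 * h 0 a * (curve r).1.1 0 j.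
Proof.
have ha : same_eig a by exact: eqxx.
have sumE : \sum_l (curve r).2 l j * (curve r).1.1 0 l ^+ 2 =
    r ^+ 2 * curve_S j - (if same_eig j then 0 else r ^+ 4 * curve_T j) + r ^+ 4 * curve_T j.
  rewrite (bigID same_eig) /=; congr (_ + _).
    rewrite (bigD1 a)//= !mxE eqxx ha /= /curve_S [in RHS](bigD1 a)//=.
    rewrite mulrDr [RHS]addrAC; congr (_ + _).
      by case: (same_eig j) => /=; ring.
    rewrite mulr_sumr; apply: eq_bigr => l /andP[hl /negbTE la].
    by rewrite !mxE la hl /= subr0; exact: mulrC.
  rewrite /curve_T mulr_sumr; apply: eq_bigr => l hl; rewrite !mxE (negbTE hl).
  have /negbTE -> : l != a by apply: contraNneq hl => ->.
  by rewrite /= subr0; ring.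
rewrite /grad sumE /= !mxE; case: ifPn => hj; first by field.
rewrite subrK /curve_w; field.
by rewrite subr_eq0 eq_sym.
Qed.

Lemma preimage_Z_curve r : X (curve r).
Proof. by apply/preimage_ZP => i j; rewrite !grad_curve; ring. Qed.

Lemma curve0 : curve 0 = jet_pt h H1.
Proof.
congr (_, _, _); first by apply/rowP => j; rewrite !mxE expr0n mul0r if_same.
  by apply/rowP => j; rewrite !mxE !mul0r subr0; case: ifPn => // /eqP ->.
by apply/matrixP => l j; rewrite !mxE expr0n mul0r if_same subr0.
Qed.

Lemma smooth_curve k : Ck k [set: R] curve.
Proof.
have cid : Ck k [set: R] (fun r : R => r) by exact: Ck_id.
have c2 : Ck k [set: R] (fun r : R => r ^+ 2) by exact: (Ck_mul openT cid cid).
have cT j : Ck k [set: R] (fun r : R => r ^+ 2 * curve_T j).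
  by apply: Ck_mul => //; [exact: openT|exact: Ck_cst].
have o := @openT R.
apply: Ck_pair => //; first apply: Ck_pair => //.
- have hf i : Ck k [set: R] (fun r => if same_eig i then r else r ^+ 2 * curve_w i).
    by case: same_eig => //; apply: Ck_mul => //; exact: Ck_cst.
  by apply: Ck_mx => // i j; apply: (Ck_ext o _ (hf j)) => r _; rewrite mxE.
- have hf i : Ck k [set: R] (fun r => if same_eig i then
      h 0 a + - (r * 2^-1 * (curve_S i + r ^+ 2 * curve_T i)) else h 0 i).
    case: same_eig => //; last exact: Ck_cst.
    apply: Ck_add => //; first exact: Ck_cst.
    apply: Ck_opp => //; apply: Ck_mul => //.
      by apply: Ck_mul => //; exact: Ck_cst.
    by apply: Ck_add => //; exact: Ck_cst.
  by apply: Ck_mx => // i j; apply: (Ck_ext o _ (hf j)) => r _; rewrite mxE.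
- have hf l j : Ck k [set: R] (fun r =>
      H1 l j + - (if (l == a) && ~~ same_eig j then r ^+ 2 * curve_T j else 0)).
    apply: Ck_add => //; first exact: Ck_cst.
    by apply: Ck_opp => //; case: (_ && _) => //; exact: Ck_cst.
  by apply: Ck_mx => // l j; apply: (Ck_ext o _ (hf l j)) => r _; rewrite mxE.
Qed.

(** The entries of x of order r^2 have zero velocity, so only the indices with h_j = h_a remain; if
    the h_j are distinct the x-part of the velocity is e_a. *)
Lemma tangent_curve (N : set J) : (\forall z \near jet_pt h H1, X z -> N z) ->
  exists k K, tangent N (jet_pt h H1) (\row_j (same_eig j)%:R, k, K).
Proof.
move=> nN; have df : differentiable curve 0 by case: (smooth_curve 1) => + _; apply.
have [v hv] : exists v, is_derive (0 : R) 1 curve v.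
  by exists ('D_1 curve 0); apply: derivableP; exact/derivable1_diffP.
have vE : v.1.1 = \row_j (same_eig j)%:R.
  apply/rowP => j; rewrite mxE.
  have [_ <-] := is_derive_entry 0 j (is_derive_fst (is_derive_fst hv)).
  rewrite (_ : (fun t : R => _) = fun r => if same_eig j then r else r * r * curve_w j); last first.
    by apply/funext => r; rewrite mxE.
  case: same_eig; first by have [_ ->] := is_derive_id (0 : R) 1.
  have did := is_derive_id (0 : R) 1.
  have [_ ->] := is_derive_mulf (is_derive_mulf did did) (is_derive_cstf 0 (curve_w j)).
  by rewrite !(mul0r, mulr0, addr0).
exists v.1.2, v.2, curve; split.
- exists setT; split; first by split => //; exact: openT.
  by move=> k; exact: smooth_curve.
- exact: curve0.
- have cc : {for 0, continuous curve} := smooth_curve 0%N (0 : R) I.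
  have nN' : nbhs (curve 0) [set z : J | X z -> N z] by rewrite curve0.
  have hN : \forall t \near (0 : R), X (curve t) -> N (curve t) := cc _ nN'.
  by apply: filterS hN => t; apply; exact: preimage_Z_curve.
- by rewrite -vE -!surjective_pairing.
Qed.

End Curve.

(** * Strata meeting E *)

Section Strata.
Context {R : realType} {d : nat}.
Local Notation J := (J1 R d).
Local Notation X := (u_map @^-1` (@Z R d)).
Variable S : set (set J).
Hypothesis wS : whitney_stratification X S.

Lemma stratum_sub N : S N -> N `<=` X.
Proof. by move=> SN z Nz; have [[-> _ _ _] _] := wS; exists N. Qed.

Lemma jet_pt_eta (z : J) : z.1.1 = 0 -> z = jet_pt z.1.2 z.2.
Proof. by case: z => [[x h] K] /= ->. Qed.

(** The bounds d - 1 <= c' < c leave no room if c = d - 1, and only c' = d - 1 if c = d. *)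
Lemma strat_neighbour N p (x : nat -> J) k c : S N -> submanifold k c N -> N p ->
  (forall n, X (x n)) -> (forall n, ~ N (x n)) -> x @ \oo --> p ->
  exists M (s : nat -> nat) k' c',
    [/\ S M, forall n, M (x (s n)), submanifold k' c' M, (c' < c)%N & (d.-1 <= c')%N].
Proof.
move=> SN sN Np Xx Nx xp; have [st _] := wS.
have [M [s [SM soo sM]]] := strat_subsequence st (stratum_sub SN Np) Xx xp.
have [_ sub _ _] := st; have [_ [k' [c' subM]]] := sub M SM.
exists M, s, k', c'; split => //.
- have xsp : x \o s @ \oo --> p by exact: cvg_comp soo xp.
  apply: (strat_higher fin_dim_jet wS SM SN _ Np sM xsp sN subM) => MN.
  by apply: (Nx (s 0%N)); rewrite -MN.
- exact: codim_ge subM (stratum_sub SM) (sM 0%N).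
Qed.

(** Equal entries separate for every s > 0; distinct ones stay distinct for s below |h_i - h_j| /
    (|i - j| + 1), where the 1 avoids a zero denominator. *)
Lemma exists_distinct (h : 'rV[R]_d) :
  \forall s \near (0 : R)^'+, forall i j : 'I_d, i != j ->
    (h + s *: \row_i (i%:R : R)) 0 i != (h + s *: \row_i (i%:R : R)) 0 j.
Proof.
apply: filter_forall => i; apply: filter_forall => j.
have [hij|hij] := eqVneq (h 0 i) (h 0 j).
  apply: filterS (nbhs_right_gt 0) => s s0 ij; rewrite !mxE hij.
  apply/eqP => /addrI/(mulfI (lt0r_neq0 s0))/eqP.
  by rewrite eqr_nat => e; move: ij; rewrite -val_eqE e.
have hij0 : 0 < `|h 0 i - h 0 j| by rewrite normr_gt0 subr_eq0.
have n0 : 0 < `|i%:R - j%:R| + 1 :> R by rewrite ltr_wpDl.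
near=> s; move=> ij; rewrite !mxE.
have s0 : 0 < s by near: s; exact: nbhs_right_gt.
have : s < `|h 0 i - h 0 j| / (`|i%:R - j%:R| + 1).
  by near: s; apply: nbhs_right_lt; exact: divr_gt0.
rewrite ltr_pdivlMr// => H; apply/eqP => E; move: H.
rewrite (_ : h 0 i - h 0 j = s * (j%:R - i%:R)); last first.
  by rewrite mulrBr; apply/eqP; rewrite subr_eq addrAC (addrC _ (h 0 j)) -E addrK.
rewrite normrM distrC (gtr0_norm s0) mulrDr mulr1 ltNge lerDl.
by rewrite ltW.
Unshelve. all: by end_near. Qed.

Lemma no_large_stratum N p k c : S N -> submanifold k c N -> (c < d)%N -> (1 < d)%N ->
  N p -> p.1.1 = 0 -> False.
Proof.
move=> SN sN cd d1 Np p0.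
have [nN|[x [xp xP]]] := near_or_sequence (fun z => X z -> N z) p; last first.
  have Xx n : X (x n) by apply: contrapT => h; exact: (xP n).
  have Nx n : ~ N (x n) by move=> h; exact: (xP n).
  have [M [s [k' [c' [_ _ _ c'c dc']]]]] := strat_neighbour SN sN Np Xx Nx xp.
  have : (c < c)%N.
    apply: (leq_ltn_trans _ c'c); apply: leq_trans dc'.
    by rewrite -ltnS prednK// (ltn_trans _ d1).
  by rewrite ltnn.
move: nN; rewrite [p]jet_pt_eta// in Np *; move: p.1.2 p.2 Np => h H1 Np nN.
pose q (s : R) := jet_pt (h + s *: \row_i (i%:R : R)) H1.
have [s [qN dis]] : exists s, (\forall z \near q s, X z -> N z) /\
    forall i j : 'I_d, i != j ->
      (h + s *: \row_i (i%:R : R)) 0 i != (h + s *: \row_i (i%:R : R)) 0 j.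
  have qc : {for 0, continuous q}.
    have : Ck 0 [set: R] q.
      apply: (Ck_pair openT); [apply: (Ck_pair openT)|]; try exact: Ck_cst.
      apply: (Ck_add openT); first exact: Ck_cst.
      by apply: (Ck_scalel openT); exact: Ck_id.
    by move=> /(_ 0 I).
  have q0 : q 0 = jet_pt h H1 by rewrite /q scale0r addr0.
  (* Coinciding locally with X is an open condition, so it persists from p to the perturbed points
     of E. *)
  have nN2 : nbhs (q 0) [set w | \forall z \near w, X z -> N z].
    by rewrite q0; have := nN => /nbhs_interior.
  have qn : \forall s \near (0 : R), \forall z \near q s, X z -> N z := qc _ nN2.
  have qn' : \forall s \near (0 : R)^'+, \forall z \near q s, X z -> N z by apply: cvg_within qn.
  have /(filterI qn') H := exists_distinct h.
  have [s [h1 h2]] := @filter_ex _ _ (at_right_proper_filter (0 : R)) _ H.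
  by exists s.
rewrite /q in qN; move: (h + _) qN dis => {q nN Np}h' qN dis.
have Nq : N (jet_pt h' H1) by exact: (nbhs_singleton qN) (preimage_Z_jet_pt _ _).
have [L [L' [K K' TE]]] := tangent_submanifold fin_dim_jet sN Nq.
(* [G] is onto and its kernel is the tangent space of N. Vanishing on TE and on vectors that span
   the x-directions modulo TE, it is zero, whereas c >= d - 1 >= 1. *)
pose G : {linear J -> 'rV[R]_c} := snd \o L.
have G1 k1 K1 : G (jet_pt k1 K1) = 0.
  have : tangent N (jet_pt h' H1) (jet_pt k1 K1).
    apply: tangent_jet_pt; apply: filterS qN => z zN z0; apply: zN.
    by rewrite (jet_pt_eta z0); exact: preimage_Z_jet_pt.
  by rewrite TE.
have inl_ : linear (fun y : 'rV[R]_d => (y, 0, 0) : J).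
  by move=> a u v; congr pair; rewrite /= ?scaler0 ?addr0//; congr pair; rewrite /= scaler0 addr0.
pose inL : {linear 'rV[R]_d -> J} := HB.pack (fun y => (y, 0, 0) : J)
     (GRing.isLinear.Build _ _ _ _ _ inl_).
have splitJ (v : J) : v = inL v.1.1 + jet_pt v.1.2 v.2.
  by case: v => [[x k1] K1]; rewrite /inL /jet_pt /=; congr (_, _, _); rewrite ?addr0 ?add0r.
have G2 i : G (inL (delta_mx 0 i)) = 0.
  have [k1 [K1]] := tangent_curve i qN; rewrite TE /= => e.
  have e' : G (inL (\row_j (same_eig h' i j)%:R) + jet_pt k1 K1) = 0.
    by rewrite -[LHS]/(G _) -(splitJ (_, k1, K1)).
  rewrite linearD G1 addr0 in e'; rewrite -[RHS]e'.
  congr (G (inL _)); apply/rowP => j; rewrite !mxE /same_eig eqxx /=.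
  have [->|/dis] := eqVneq j i; first by rewrite eqxx.
  by move=> /negbTE ->.
have G0 v : G v = 0.
  rewrite (splitJ v) linearD G1 addr0 [v.1.1]row_sum_delta !linear_sum big1// => i _.
  by rewrite !linearZ G2; exact: scaler0.
have c0 : (0 < c)%N.
  by apply: (leq_trans _ (codim_ge sN (stratum_sub SN) Nq)); rewrite -ltnS prednK// ltnW.
have := G0 (L' (0, const_mx 1)); rewrite /G /= K' /= => /rowP/(_ (Ordinal c0)).
by rewrite !mxE => /eqP; rewrite oner_eq0.
Qed.

End Strata.

(** * Distinctness of the h_i on strata of codimension d *)

Section Distinct.
Context {R : realType} {d : nat}.
Local Notation J := (J1 R d).
Local Notation X := (u_map @^-1` (@Z R d)).

(* The linearisation of g_a x_b = g_b x_a at a point of the curve, divided by r^2. *)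
Lemma tangent_curve_pt (h : 'rV[R]_d) (H1 : 'M[R]_d) a b (r : R) (v : J) (M : set J) :
  h 0 b = h 0 a -> r != 0 -> M `<=` X -> tangent M (curve h H1 a r) v ->
  let xi l : R := if same_eig h a l then 1 else r * curve_w h H1 a l in
  let K := (curve h H1 a r).2 in
  2 * (v.1.2 0 a - v.1.2 0 b)
  - (curve_S h H1 a a + r ^+ 2 * curve_T h H1 a a) * v.1.1 0 a
  + (curve_S h H1 a b + r ^+ 2 * curve_T h H1 a b) * v.1.1 0 b
  + \sum_l (r * ((v.2 l a - v.2 l b) * xi l ^+ 2) + 2 * (K l a - K l b) * (xi l * v.1.1 0 l)) = 0.
Proof.
move=> hba r0 MX /(tangent_preimage_Z a b MX) H xi K; move: H; rewrite !grad_curve => H.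
have ha : same_eig h a a by exact: eqxx.
have hb : same_eig h a b by rewrite /same_eig hba.
have xE l : (curve h H1 a r).1.1 0 l = r * xi l.
  by rewrite /xi /= mxE; case: ifP => _; rewrite ?mulr1// expr2 mulrA.
move: H; rewrite /dgrad.
have -> : (curve h H1 a r).1.2 0 a = h 0 a - r / 2 * (curve_S h H1 a a + r ^+ 2 * curve_T h H1 a a).
  by rewrite /= mxE ha.
have -> : (curve h H1 a r).1.2 0 b = h 0 a - r / 2 * (curve_S h H1 a b + r ^+ 2 * curve_T h H1 a b).
  by rewrite /= mxE hb.
rewrite -/K.
have sumE j : \sum_l (v.2 l j * (curve h H1 a r).1.1 0 l ^+ 2 +
     K l j * (2 * (curve h H1 a r).1.1 0 l * v.1.1 0 l)) =
   r * \sum_l (r * (v.2 l j * xi l ^+ 2) + 2 * K l j * (xi l * v.1.1 0 l)).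
  by rewrite mulr_sumr; apply: eq_bigr => l _; rewrite xE; ring.
have xia : xi a = 1 by rewrite /xi ha.
have xib : xi b = 1 by rewrite /xi hb.
rewrite !sumE !xE xia xib !mulr1.
set A := \sum_l _; set B := \sum_l _ => H.
have -> : \sum_l (r * ((v.2 l a - v.2 l b) * xi l ^+ 2) +
    2 * (K l a - K l b) * (xi l * v.1.1 0 l)) = A - B.
  by rewrite -sumrB; apply: eq_bigr => l _; ring.
(* The terms of order r, namely 2 h_a r (v_a + v_b) with v the x-part, occur on both sides and
   cancel because h_b = h_a; the rest is divisible by r^2. *)
have r2 : r * r != 0 by rewrite mulf_neq0.
apply: (mulfI r2); rewrite mulr0.
rewrite -[RHS](subrr ((2 * (v.1.2 0 a * r + (h 0 a -
  r / 2 * (curve_S h H1 a a + r ^+ 2 * curve_T h H1 a a)) * v.1.1 0 a) + r * A) * r +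
  2 * h 0 a * r * v.1.1 0 b)).
by rewrite {2}H; field.
Qed.

Variable S : set (set J).
Hypothesis wS : whitney_stratification X S.

Lemma distinct_of_codim N k (h : 'rV[R]_d) (H1 : 'M[R]_d) a b : S N -> submanifold k d N ->
  (1 < d)%N -> N (jet_pt h H1) -> a != b -> h 0 a != h 0 b.
Proof.
move=> SN sN d1 Np ab.
(* Otherwise a stratum of codimension less than d would contain points of E, against
   [no_large_stratum]. *)
have EN : \forall z \near jet_pt h H1, z.1.1 = 0 -> N z.
  have [//|[x [xp xP]]] := near_or_sequence (fun z : J => z.1.1 = 0 -> N z) (jet_pt h H1).
  have x0 n : (x n).1.1 = 0 by apply: contrapT => h0; exact: (xP n).
  have Nx n : ~ N (x n) by move=> h0; exact: (xP n).
  have Xx n : X (x n) by rewrite (jet_pt_eta (x0 n)); exact: preimage_Z_jet_pt.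
  have [M [s [k' [c' [SM Ms subM c'd _]]]]] := strat_neighbour wS SN sN Np Xx Nx xp.
  exact: False_ind (no_large_stratum wS SM subM c'd d1 (Ms 0%N) (x0 _)).
apply/negP => /eqP hab.
(* The vector that refutes the limit equation: its x-part and its H1-part vanish and its h-part is
   e_a, so the equation becomes 2 (1 - 0) = 0. *)
have Tv : tangent N (jet_pt h H1) (jet_pt (delta_mx 0 a) 0) := tangent_jet_pt _ _ EN.
pose r (n : nat) : R := n.+1%:R^-1.
have r0 n : r n != 0 by rewrite /r invr_eq0.
have roo : r @ \oo --> 0 by exact: cvg_harmonic.
have cc : {for 0, continuous (curve h H1 a)} := smooth_curve h H1 a 0%N (0 : R) I.
have xp : curve h H1 a (r n) @[n --> \oo] --> jet_pt h H1.
  by rewrite -(curve0 h H1 a); exact: (cvg_comp _ _ roo cc).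
have Xx n : X (curve h H1 a (r n)) by exact: preimage_Z_curve.
have [M [s [w [SM soo wv MT]]]] := tangent_limit fin_dim_jet wS SN Np Xx xp Tv.
pose q n := r (s n).
have qoo : q @ \oo --> 0 by exact: (cvg_comp _ _ soo roo).
have w1 : (fun n => (w n).1) @ \oo --> (jet_pt (delta_mx 0 a) 0).1.
  exact: (cvg_comp _ _ wv cvg_fst).
have wx j : (w n).1.1 0 j @[n --> \oo] --> (0 : R).
  have := cvg_comp _ _ (cvg_comp _ _ w1 cvg_fst) (@coord_continuous _ _ _ 0 j _).
  by rewrite /= mxE => H; exact: H.
have wh j : (w n).1.2 0 j @[n --> \oo] --> ((j == a)%:R : R).
  have := cvg_comp _ _ (cvg_comp _ _ w1 cvg_snd) (@coord_continuous _ _ _ 0 j _).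
  by rewrite /= mxE eqxx => H; exact: H.
have wK l j : (w n).2 l j @[n --> \oo] --> (0 : R).
  have := cvg_comp _ _ (cvg_comp _ _ wv cvg_snd) (@coord_continuous _ _ _ l j _).
  by rewrite /= mxE => H; exact: H.
have xs : curve h H1 a (q n) @[n --> \oo] --> jet_pt h H1 by exact: (cvg_comp _ _ soo xp).
have Kc l j : (curve h H1 a (q n)).2 l j @[n --> \oo] --> H1 l j.
  exact: (cvg_comp _ _ (cvg_comp _ _ xs cvg_snd) (@coord_continuous _ _ _ l j _)).
have xic l : (if same_eig h a l then 1 else q n * curve_w h H1 a l) @[n --> \oo] -->
   ((same_eig h a l)%:R : R).
  case: (same_eig h a l); first exact: cvg_cst.
  rewrite (_ : false%:R = 0 * curve_w h H1 a l); last by rewrite mul0r.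
  by apply: cvgM => //; exact: cvg_cst.
have E n := tangent_curve_pt (esym hab) (r0 (s n)) (stratum_sub wS SM) (MT n).2.
have STc j : curve_S h H1 a j + q n ^+ 2 * curve_T h H1 a j @[n --> \oo] -->
   curve_S h H1 a j + 0 ^+ 2 * curve_T h H1 a j.
  apply: cvgD; first exact: cvg_cst.
  apply: cvgM; last exact: cvg_cst.
  exact: (cvgM qoo qoo).
pose xi l n := if same_eig h a l then 1 else q n * curve_w h H1 a l.
pose K n := (curve h H1 a (q n)).2.
pose tail : R := \sum_l (0 * ((0 - 0) * (same_eig h a l)%:R ^+ 2) +
  2 * (H1 l a - H1 l b) * ((same_eig h a l)%:R * 0)).
have sumc : (\sum_l (q n * (((w n).2 l a - (w n).2 l b) * xi l n ^+ 2) +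
    2 * (K n l a - K n l b) * (xi l n * (w n).1.1 0 l))) @[n --> \oo] --> tail.
  apply: (@cvg_big R _ +%R 0 xpredT); first exact: add_continuous.
  move=> l _; apply: cvgD.
    apply: cvgM => //; apply: cvgM; first exact: cvgB.
    exact: (cvgM (xic l) (xic l)).
  apply: cvgM; last exact: (cvgM (xic l) (wx l)).
  by apply: cvgM; [exact: cvg_cst|exact: (cvgB (Kc l a) (Kc l b))].
have head : 2 * ((w n).1.2 0 a - (w n).1.2 0 b) @[n --> \oo] -->
    (2 * ((a == a)%:R - (b == a)%:R) : R).
  exact: (cvgM (cvg_cst (2 : R)) (cvgB (wh a) (wh b))).
have lim := cvgD (cvgD (cvgB head (cvgM (STc a) (wx a))) (cvgM (STc b) (wx b))) sumc.
pose total := 2 * ((a == a)%:R - (b == a)%:R) -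
  (curve_S h H1 a a + 0 ^+ 2 * curve_T h H1 a a) * 0 +
  (curve_S h H1 a b + 0 ^+ 2 * curve_T h H1 a b) * 0 + tail.
have L0 : (fun=> 0 : R) @ \oo --> total.
  apply: cvg_trans (lim _ _ _ _ _); apply: near_eq_cvg; apply: nearW => n.
  exact: (E n).
have /eqP : total = 0 by apply: (cvg_unique _ L0) => //; exact: cvg_cst.
rewrite /total /tail big1 => [|l _]; last by rewrite !(mul0r, mulr0, addr0).
by rewrite eqxx (eq_sym b) (negbTE ab) !(mul0r, mulr0, addr0, subr0) mulr1 pnatr_eq0.
Qed.

End Distinct.

(** * The arcs of the tangency set *)

Section MatrixCk.
Context {R : realType} {V : normedModType R}.
Variable U : set V.
Hypothesis oU : open U.

Lemma Ck_mulmx k m n p (A : V -> 'M[R]_(m, n)) (B : V -> 'M[R]_(n, p)) :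
  Ck k U A -> Ck k U B -> Ck k U (fun x => A x *m B x).
Proof.
move=> hA hB; apply: Ck_mx => // i j.
have H : Ck k U (fun x => \sum_l A x i l * B x l j).
  by apply: Ck_sum => // l; apply: Ck_mul => //; exact: Ck_coord.
by apply: (Ck_ext oU _ H) => x _; rewrite mxE.
Qed.

Lemma Ck_det k n (A : V -> 'M[R]_n) : Ck k U A -> Ck k U (fun x => \det (A x)).
Proof.
move=> hA; apply: Ck_sum => // s; apply: Ck_mul => //; first exact: Ck_cst.
by apply: Ck_prod => // i; exact: Ck_coord.
Qed.

(** Cramer's rule: the entries are quotients of determinants. *)
Lemma Ck_invmx k n (A : V -> 'M[R]_n) : (forall x, U x -> \det (A x) != 0) ->
  Ck k U A -> Ck k U (fun x => invmx (A x)).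
Proof.
move=> A0 hA; have H : Ck k U (fun x => (\det (A x))^-1 *: \adj (A x)).
  apply: Ck_mx => // i j.
  have H : Ck k U (fun x => (\det (A x))^-1 * ((-1) ^+ (j + i) * \det (row' j (col' i (A x))))).
    apply: Ck_mul => //; first by apply: Ck_inv => //; exact: Ck_det.
    apply: Ck_mul => //; first exact: Ck_cst.
    apply: Ck_det; apply: Ck_mx => // l m.
    by apply: (Ck_ext oU _ (Ck_coord oU (lift j l) (lift i m) hA)) => x _; rewrite !mxE.
  by apply: (Ck_ext oU _ H) => x _; rewrite !mxE.
apply: (Ck_ext oU _ H) => x Ux; rewrite /invmx unitmxE unitfE A0 //.
Qed.

End MatrixCk.

(* A minimum of |w - f w| on the ball is a zero. *)
Lemma contraction_fixpoint (R : realType) m (f : 'rV[R]_m -> 'rV[R]_m) r : 0 <= r ->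
  (forall w, `|w| <= r -> `|f w| <= r) ->
  (forall w w', `|w| <= r -> `|w'| <= r -> `|f w - f w'| <= 2^-1 * `|w - w'|) ->
  exists2 w, `|w| <= r & w = f w.
Proof.
move=> r0 fr fc; pose A := [set w : 'rV[R]_m | `|w| <= r].
have cA : compact A.
  apply: bounded_closed_compact.
    by exists r; split => [|x rx w /= wr]; [exact: num_real|exact: le_trans wr (ltW rx)].
  by apply: (@closed_comp _ _ (fun w : 'rV[R]_m => `|w|) [set x : R | x <= r]);
    [move=> w _; exact: norm_continuous|exact: closed_le].
have [||c cA' cmin] := @EVT_min_rV R m (fun w => `|w - f w|) A _ cA.
- by exists 0; rewrite /A /= normr0.
- apply/subspace_continuousP => w Aw; apply/cvgrPdist_le => e e0.
  have e4 : 0 < e / 2 by rewrite divr_gt0.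
  have : \forall z \near w, `|w - z| <= e / 2.
    apply/nbhs_ballP; exists (e / 2) => //= z; rewrite -ball_normE /=; exact: ltW.
  move=> h; near=> z.
  have zA : A z by near: z; exact: withinT.
  have wz : `|w - z| <= e / 2 by near: z; exact: cvg_within h.
  apply: (le_trans (ler_dist_dist _ _)).
  have -> : w - f w - (z - f z) = (w - z) - (f w - f z).
    by rewrite !opprB [f z - z]addrC addrACA [- f w + _]addrC.
  apply: (le_trans (ler_normB _ _)).
  have := fc w z Aw zA => fwz.
  rewrite (splitr e); apply: lerD => //; apply: le_trans fwz _.
  by apply: le_trans wz; rewrite ler_piMl// invf_le1// ler1n.
rewrite inE in cA'; exists c => //; apply/eqP; rewrite -subr_eq0 -normr_le0.
have fA : f c \in A by rewrite inE; exact: fr.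
have h1 := cmin _ fA; have h2 := fc _ _ cA' (fr _ cA').
have := le_trans h1 h2.
lra.
Unshelve. all: by end_near. Qed.

(** * The smooth solution of w = t P(t, w) *)

Section ImplicitArc.
Context {R : realType} {m : nat}.
Local Notation W := 'rV[R]_m.
Variables (P : R * W -> W) (O : set (R * W)).
Hypotheses (oO : open O) (O0 : O (0, 0)) (sP : smooth_on O P).

Let fW : fin_dim W := fin_dim_mx 1 m.
Let fRW : fin_dim (R * W)%type := fin_dim_prod fin_dim_R fW.

(* The solution omega of w = t P(t, w) satisfies
   omega' = (P + t part_t) (1 - t part_w)^-1, all evaluated at (t, omega(t)),
   with matrices acting on row vectors from the right. *)
Definition part_w (z : R * W) : 'M[R]_m := \matrix_(i, j) ('d P z (0, delta_mx 0 i)) 0 j.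
Definition part_t (z : R * W) : W := 'd P z (1, 0).
Definition lin_w (z : R * W) : 'M[R]_m := 1%:M - z.1 *: part_w z.

Lemma diff_parts z (h : R) (w : W) : 'd P z (h, w) = h *: part_t z + w *m part_w z.
Proof.
have -> : (h, w) = h *: (1, 0) + \sum_i w 0 i *: (0, delta_mx 0 i) :> R * W.
  have -> : \sum_i w 0 i *: (0, delta_mx 0 i) = (0, w) :> R * W.
    rewrite [in RHS](row_sum_delta w).
    elim/big_rec2: _ => // i x y _ ->.
    by congr pair; rewrite /= scaler0 add0r.
  by congr pair; rewrite /= ?scaler0 ?add0r ?addr0// [_ *: 1]mulr1.
rewrite linearD linearZ linear_sum; congr (_ + _).
rewrite [X in X *m _]row_sum_delta mulmx_suml; apply: eq_bigr => i _.
rewrite linearZ -scalemxAl; congr (_ *: _); rewrite -rowE.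
by apply/rowP => j; rewrite !mxE.
Qed.

Lemma Ck_part_w k : Ck k O part_w.
Proof.
have [_ h] := sP k.+1; apply: Ck_mx => // i j.
have H := Ck_coord oO 0 j (h (0, delta_mx 0 i)).
by apply: (Ck_ext oO _ H) => z _; rewrite mxE.
Qed.

Lemma Ck_lin_w k : Ck k O lin_w.
Proof.
suff h : Ck k O (fun z => z.1 *: part_w z).
  exact: (Ck_add oO (Ck_cst k O (1%:M : 'M[R]_m)) (Ck_opp oO h)).
apply: Ck_mx => // i j.
have H : Ck k O (fun z => z.1 * part_w z i j).
  apply: Ck_mul => //; first by apply: Ck_fst => //; exact: Ck_id.
  by apply: Ck_coord => //; exact: Ck_part_w.
by apply: (Ck_ext oO _ H) => z _; rewrite [RHS]mxE.
Qed.

Lemma implicit_box : exists d K B : R, [/\ 0 < d, 0 < K, 0 < B,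
  forall z, ball (0, 0) d z -> [/\ O z, \det (lin_w z) != 0 & `|P z| <= B] &
  forall z z', ball (0, 0) d z -> ball (0, 0) d z' -> `|P z - P z'| <= K * `|z - z'|].
Proof.
have [K [K0 [d1 d10 hK]]] := locally_lipschitz fRW fW oO (sP 1) O0.
have det0 : \det (lin_w (0, 0)) = 1 by rewrite /lin_w /= scale0r subr0 det1.
have dc : {for (0, 0), continuous (fun z => \det (lin_w z))}.
  exact: (Ck_continuous (Ck_det oO (Ck_lin_w 0)) O0).
have dn : \forall z \near ((0, 0) : R * W), \det (lin_w z) != 0.
  have h : nbhs (\det (lin_w (0, 0))) [set x | x != 0].
    by rewrite det0; apply: open_nbhs_nbhs; split; [exact: open_neq|exact: oner_neq0].
  exact: (dc _ h).
have nO : \forall z \near ((0, 0) : R * W), O z by exact: open_nbhs_nbhs.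
have /nbhs_ballP[d2 /= d20 h2] : \forall z \near ((0, 0) : R * W), O z /\ \det (lin_w z) != 0.
  exact: filterI.
pose d := Num.min d1 d2; have d0 : 0 < d by rewrite lt_min d10.
exists d, K, (`|P (0, 0)| + K * d); split => //.
- by rewrite ltr_wpDl// mulr_gt0.
- move=> z zd; have [Oz dz] : O z /\ \det (lin_w z) != 0.
    by apply: h2; apply: le_ball zd; rewrite ge_min lexx orbT.
  split => //; rewrite -[P z](subrK (P (0, 0))) addrC.
  apply: (le_trans (ler_normD _ _)); apply: lerD => //.
  have zd1 : ball (0, 0) d1 z by apply: le_ball zd; rewrite ge_min lexx.
  apply: (le_trans (hK _ _ zd1 (ballxx _ d10))).
  rewrite ler_pM2l// ltW// distrC; by move: zd; rewrite -ball_normE.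
- by move=> z z' zd zd'; apply: hK; [apply: le_ball zd|apply: le_ball zd']; rewrite ge_min lexx.
Qed.


(** For small t the map w |-> t P(t, w) is a 1/2-contraction of the closed ball of radius r into its
    interior: existence and uniqueness. The solution is then Lipschitz, next differentiable with
    derivative v(t, om t) for a smooth v, and this differential equation lifts C^k to C^(k+1). *)
Lemma implicit_arc : exists (e r : R) (om : R -> W),
  [/\ 0 < e, 0 < r <= 1, forall k, Ck k [set t | `|t| < e] om,
    forall t, `|t| < e -> `|om t| < r /\ om t = t *: P (t, om t) &
    forall t w, `|t| < e -> `|w| < r -> w = t *: P (t, w) -> w = om t].
Proof.
have [d [K [B [d0 K0 B0 hB hK]]]] := implicit_box.
(* The bound 1 will keep the arcs in the cone |x_j| <= |x_i|; d / 2 keeps the closed ball of radius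
   r in the box. *)
pose r := Num.min 1 (d / 2).
have r0 : 0 < r by rewrite lt_min ltr01 divr_gt0.
have rd : r < d by rewrite gt_min [d / 2 < d]ltr_pdivrMr// ltr_pMr// ltr1n orbT.
(* One summand for each requirement on e = 1 / T: e <= r, e K <= 1/2 and e B < r, the last one
   strict by the factor 2. *)
pose T := r^-1 + 2 * K + 2 * B / r.
have T0 : 0 < T by rewrite !addr_gt0 ?invr_gt0 ?divr_gt0 ?mulr_gt0.
pose e := T^-1; have e0 : 0 < e by rewrite invr_gt0.
have er : e <= r.
  rewrite -[r]invrK lef_pV2 ?posrE ?invr_gt0// /T -addrA lerDl.
  by rewrite addr_ge0 ?divr_ge0 ?mulr_ge0 ?ltW.
have eK : e * K <= 2^-1.
  rewrite mulrC ler_pdivrMr// mulrC ler_pdivlMr// mulrC /T addrAC lerDr.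
  by rewrite addr_ge0 ?divr_ge0 ?mulr_ge0 ?invr_ge0 ?ltW.
have eB : e * B < r.
  rewrite mulrC ltr_pdivrMr// mulrC -ltr_pdivrMr// /T.
  have : B / r < 2 * B / r by rewrite -mulrA ltr_pMl ?ltr1n// divr_gt0.
  move/lt_le_trans; apply; rewrite lerDr.
  by rewrite addr_ge0 ?mulr_ge0 ?invr_ge0 ?ltW.
have inb (t : R) (w : W) : `|t| < e -> `|w| <= r -> ball ((0, 0) : R * W) d (t, w).
  move=> te wr; rewrite -ball_normE /= prod_normE /= !sub0r !normrN gt_max.
  by rewrite (lt_trans (lt_le_trans te er) rd) (le_lt_trans wr rd).
have fr (t : R) (w : W) : `|t| < e -> `|w| <= r -> `|t *: P (t, w)| < r.
  move=> te wr; have [_ _ h] := hB _ (inb t w te wr).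
  rewrite normrZ; apply: le_lt_trans eB; apply: ler_pM => //; exact: ltW.
have fc (t : R) (w w' : W) : `|t| < e -> `|w| <= r -> `|w'| <= r ->
    `|t *: P (t, w) - t *: P (t, w')| <= 2^-1 * `|w - w'|.
  move=> te wr w'r; rewrite -scalerBr normrZ.
  have := hK _ _ (inb t w te wr) (inb t w' te w'r).
  rewrite (_ : `|(t, w) - (t, w')| = `|w - w'|); last first.
    by rewrite prod_normE /= subrr normr0; apply/max_idPr.
  move=> h; apply: (@le_trans _ _ (e * (K * `|w - w'|))).
    by apply: ler_pM => //; exact: ltW.
  by rewrite mulrA; apply: ler_wpM2r.
have /choice[om omP] : forall t : R, exists w, `|t| < e -> `|w| < r /\ w = t *: P (t, w).
  move=> t; have [te|] := boolP (`|t| < e); last by exists 0.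
  have [|||w wr wE] := @contraction_fixpoint R m (fun w => t *: P (t, w)) r.
  - exact: ltW.
  - by move=> w wr; apply: ltW; exact: fr.
  - by move=> w w'; exact: fc.
  by exists w => _; split => //; rewrite wE; exact: fr.
have omu t w : `|t| < e -> `|w| < r -> w = t *: P (t, w) -> w = om t.
  move=> te wr wE; have [or oE] := omP t te; apply/eqP; rewrite -subr_eq0 -normr_le0.
  have := fc t w (om t) te (ltW wr) (ltW or); rewrite -wE -oE.
  by have := normr_ge0 (w - om t); lra.
pose I := [set t : R | `|t| < e].
have oI : open I.
  by apply: (@open_comp _ _ (fun t : R => `|t|) [set x : R | x < e]);
    [move=> ? _; exact: norm_continuous|exact: open_lt].
have inI t : I t -> ball ((0, 0) : R * W) d (t, om t).
  by move=> It; apply: inb => //; apply: ltW; case: (omP t It).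
(* Subtracting the fixed-point equations gives |om t - om s| <= (|t - s| + |om t - om s|) / 2 + B |t
   - s|; absorbing |om t - om s| / 2 yields 1 + 2 B. *)
have lip t s : I t -> I s -> `|om t - om s| <= (1 + 2 * B) * `|t - s|.
  move=> It Is; have [_ otE] := omP t It; have [_ osE] := omP s Is.
  have := hK _ _ (inI t It) (inI s Is).
  have [_ _ Bs] := hB _ (inI s Is).
  have := normr_ge0 (om t - om s); have := normr_ge0 (t - s).
  have : `|om t - om s| <= e * `|P (t, om t) - P (s, om s)| + `|t - s| * B.
    rewrite {1}otE {1}osE.
    have -> : t *: P (t, om t) - s *: P (s, om s) =
        t *: (P (t, om t) - P (s, om s)) + (t - s) *: P (s, om s).
      by rewrite scalerBr scalerBl addrA subrK.
    apply: (le_trans (ler_normD _ _)); rewrite !normrZ; apply: lerD.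
      by apply: ler_wpM2r => //; exact: ltW.
    exact: ler_wpM2l.
  rewrite prod_normE /= => h1 h2 h3 h4.
  have h5 : Num.max `|t - s| `|om t - om s| <= `|t - s| + `|om t - om s|.
    by rewrite ge_max lerDl lerDr h2 h3.
  have h6 : e * `|P (t, om t) - P (s, om s)| <= 2^-1 * (`|t - s| + `|om t - om s|).
    apply: (@le_trans _ _ (e * (K * (`|t - s| + `|om t - om s|)))).
      apply: ler_wpM2l; first exact: ltW.
      by apply: le_trans h4 _; apply: ler_wpM2l => //; exact: ltW.
    by rewrite mulrA; apply: ler_wpM2r => //; exact: addr_ge0.
  nra.
have C0 : 0 < 1 + 2 * B by rewrite addr_gt0// mulr_gt0.
have nI s : I s -> \forall t \near s, I t by move=> Is; exact: open_nbhs_nbhs.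
have omc s : I s -> {for s, continuous om}.
  move=> Is; apply/cvgrPdist_le => e1 e10; near=> t.
  have It : I t by near: t; exact: nI.
  apply: (le_trans (lip s t Is It)); rewrite -ler_pdivlMl// mulrC.
  near: t; apply/nbhs_ballP; exists (e1 / (1 + 2 * B)) => /=; first exact: divr_gt0.
  by move=> t /=; exact: ltW.
pose v (z : R * W) : W := (P z + z.1 *: part_t z) *m invmx (lin_w z).
have vlin s : linear (fun h : R => h *: v (s, om s)).
  by move=> a x y; rewrite scalerDl scalerA.
pose vL s : {linear R -> W} := HB.pack (fun h : R => h *: v (s, om s))
  (GRing.isLinear.Build _ _ _ _ _ (vlin s)).
have omd s : I s -> is_diff s om (vL s).
  move=> Is; pose z := (s, om s); have [Oz detz Pz] := hB _ (inI s Is).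
  have uA : lin_w z \in unitmx by rewrite unitmxE unitfE.
  have dP : differentiable P z by case: (sP 1) => h _; exact: h.
  have [k k0 hk] : exists2 k, 0 < k & forall x : W, `|x *m invmx (lin_w z)| <= k * `|x|.
    have cl : continuous (mulmxr (invmx (lin_w z)) : {linear W -> W}).
      exact: linear_fin_dim_continuous.
    exact: linear_lipschitz cl.
  apply: is_diff_eps => [|e1 e10]; first exact: linear_fin_dim_continuous fin_dim_R.
  pose C' := 1 + (1 + 2 * B); have C'0 : 0 < C' by rewrite addr_gt0.
  (* This constant and the bound [ht] below make each of the two error terms of [key] at most half
     of e1 |t - s|, after the factor k of [invmx (lin_w z)]. *)
  pose e2 := e1 / (2 * k * e * C').
  have e20 : 0 < e2 by rewrite divr_gt0// !mulr_gt0.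
  have cz : {for s, continuous (fun t => (t, om t))}.
    exact: (cvg_pair (F := nbhs s) (G := nbhs s) (H := nbhs (om s)) (f := id) cvg_id (omc s Is)).
  have E1 : \forall t \near s,
      `|P (t, om t) - P z - 'd P z ((t, om t) - z)| <= e2 * `|(t, om t) - z|.
    exact: (cz _ (differentiable_eps dP e20)).
  near=> t.
  have It : I t by near: t; exact: nI.
  have hE : `|P (t, om t) - P z - 'd P z ((t, om t) - z)| <= e2 * `|(t, om t) - z| by near: t.
  have ht : `|t - s| <= e1 / (2 * k * K * C').
    near: t; apply/nbhs_ballP; exists (e1 / (2 * k * K * C')) => /=.
      by rewrite divr_gt0// !mulr_gt0.
    by move=> t /=; rewrite distrC; exact: ltW.
  set E := P (t, om t) - P z - _ in hE.
  have hz : `|(t, om t) - z| <= C' * `|t - s|.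
    rewrite prod_normE /= ge_max; apply/andP; split.
      by rewrite ler_peMl// /C' lerDl ltW.
    by apply: le_trans (lip _ _ It Is) _; rewrite ler_wpM2r// /C' lerDr.
  have [_ otE] := omP t It; have [_ osE] := omP s Is.
  (* In the difference of the two fixed-point equations, the term in [part_w z] moved to the left
     makes [lin_w z] act on om t - om s; the right-hand side is an exact remainder. *)
  have key : om t - om s - (t - s) *: v z =
      (s *: E + (t - s) *: (P (t, om t) - P z)) *m invmx (lin_w z).
    apply: (canRL (mulmxK uA)); rewrite mulmxBl -scalemxAl /v mulmxKV//.
    rewrite [lin_w z]/(1%:M - s *: part_w z) mulmxBr mulmx1 -scalemxAr.
    rewrite /E (_ : (t, om t) - z = (t - s, om t - om s))// diff_parts.
    rewrite {1}otE {1}osE -/z.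
    set D := (om t - om s) *m part_w z; set P1 := P (t, om t); set Q := part_t z.
    apply/rowP => j; rewrite !mxE /=; ring.
  rewrite [vL s _]/((t - s) *: v z) key; apply: (le_trans (hk _)).
  have hP : `|P (t, om t) - P z| <= K * (C' * `|t - s|).
    apply: le_trans (hK _ _ (inI t It) (inI s Is)) _.
    by rewrite ler_wpM2l// ltW.
  have hE2 : `|s *: E| <= e * (e2 * (C' * `|t - s|)).
    rewrite normrZ; apply: ler_pM => //; first exact: ltW.
    by apply: le_trans hE _; rewrite ler_wpM2l// ltW.
  have h3 : `|(t - s) *: (P (t, om t) - P z)| <= `|t - s| * (K * (C' * (e1 / (2 * k * K * C')))).
    rewrite normrZ ler_wpM2l//; apply: le_trans hP _.
    apply: ler_wpM2l; first exact: ltW.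
    by apply: ler_wpM2l; first exact: ltW.
  apply: (@le_trans _ _ (k * (e * (e2 * (C' * `|t - s|)) +
      `|t - s| * (K * (C' * (e1 / (2 * k * K * C'))))))).
    apply: ler_wpM2l; first exact: ltW.
    by apply: le_trans (ler_normD _ _) _; exact: lerD.
  rewrite le_eqVlt; apply/orP; left; apply/eqP; rewrite /e2; field.
  by rewrite !gt_eqF.
have sv k : Ck k (ball ((0, 0) : R * W) d) v.
  have oB : open (ball ((0, 0) : R * W) d) by exact: ball_open.
  have subO : ball ((0, 0) : R * W) d `<=` O by move=> z /hB[].
  apply: Ck_mulmx => //.
    apply: Ck_add => //; first exact: Ck_sub subO (sP k).
    have h1 : Ck k (ball ((0, 0) : R * W) d) part_t.
      by have [_ h] := sP k.+1; exact: Ck_sub subO (h (1, 0)).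
    apply: Ck_mx => // i j.
    have H : Ck k (ball ((0, 0) : R * W) d) (fun z => z.1 * part_t z i j).
      apply: Ck_mul => //; first by apply: Ck_fst => //; exact: Ck_id.
      exact: Ck_coord.
    by apply: (Ck_ext oB _ H) => z _; rewrite [RHS]mxE.
  apply: Ck_invmx => //; first by move=> z /hB[].
  exact: Ck_sub subO (Ck_lin_w k).
exists e, r, om; split => //.
- by rewrite r0 ge_min lexx.
(* Bootstrap: the derivative v(t, om t) is C^k as soon as [om] is. *)
- move=> k; elim: k => [|k IH]; first by move=> s Is; exact: omc.
  apply: (Ck_diff oI (df := fun s h => vL s h) omd) => h.
  have H : Ck k I (v \o (fun s => (s, om s))).
    apply: (Ck_comp oI (@ball_open _ _ _ _) fRW fW inI (sv k)).
    by apply: Ck_pair => //; exact: Ck_id.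
  apply: Ck_mx => // i j.
  have H2 : Ck k I (fun s => h * v (s, om s) i j).
    by apply: Ck_mul => //; [exact: Ck_cst|exact: (Ck_coord oI i j H)].
  by apply: (Ck_ext oI _ H2) => s _; rewrite [RHS]mxE.
Unshelve. all: by end_near. Qed.

End ImplicitArc.

(** * Branches of the tangency set in a cone around an axis *)

Section Arcs.
Context {R : realType} {d : nat}.
Implicit Types (x : 'rV[R]_d) (i j l : 'I_d).

Lemma rV_norm_le n (x : 'rV[R]_n) c : 0 <= c -> (`|x| <= c) = [forall j, `|x 0 j| <= c].
Proof.
move=> c0; apply/idP/forallP => [h j|h].
  apply: le_trans h; rewrite [leRHS]/Num.Def.normr/= mx_normrE.
  by apply: (le_bigmax _ (fun ij : 'I_1 * 'I_n => `|x ij.1 ij.2|) (0, j)).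
rewrite [leLHS]/Num.Def.normr/= mx_normrE; apply: bigmax_le => // -[p q] _ /=.
by rewrite ord1.
Qed.

Lemma rV_coord_le n (x : 'rV[R]_n) (j : 'I_n) : `|x 0 j| <= `|x|.
Proof. by move: (lexx `|x|); rewrite rV_norm_le// => /forallP. Qed.

Variables (f : 'rV[R]_d -> R) (H : 'rV[R]_d -> 'rV[R]_d).

Definition dH x j l : R := ('d H x (delta_mx 0 j)) 0 l.
(** The partial derivatives of sum H_l x_l^2. *)
Definition gradf x j : R := 2 * H x 0 j * x 0 j + \sum_l dH x j l * x 0 l ^+ 2.
Definition tangency x := forall j k, gradf x j * x 0 k = gradf x k * x 0 j.

Lemma derive_quadratic x j : differentiable H x ->
  (\forall y \near x, f y = \sum_i H y 0 i * y 0 i ^+ 2) ->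
  'D_(delta_mx 0 j) f x = gradf x j.
Proof.
move=> df fE; rewrite (near_eq_derive _ fE).
have cL l : continuous (mx_coord 0 l : {linear 'rV[R]_d -> R}).
  by move=> M; exact: coord_continuous.
have cH l : is_derive x (delta_mx 0 j) (fun y => H y 0 l) (dH x j l).
  have dL := @linear_differentiable _ _ _ _ (H x) (cL l).
  have := is_diff_is_derive (delta_mx 0 j) (differentiableP (differentiable_comp df dL)).
  by rewrite diff_comp// [X in is_derive _ _ _ X]/comp diff_lin.
have cx l : is_derive x (delta_mx 0 j) (fun y : 'rV[R]_d => y 0 l) ((l == j)%:R : R).
  have := is_diff_is_derive (delta_mx 0 j)
    (differentiableP (@linear_differentiable _ _ _ _ x (cL l))).
  by rewrite diff_lin// /mx_coord /= mxE.
have ds := is_derive_sum (fun l => is_derive_mulf (cH l) (is_derive_mulf (cx l) (cx l))).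
have -> : (fun y => \sum_i H y 0 i * y 0 i ^+ 2) = \sum_l (fun y => H y 0 l * (y 0 l * y 0 l)).
  by apply/funext => y; rewrite fct_sumE.
have [_ ->] := ds.
rewrite big_split /= /gradf [LHS]addrC; congr (_ + _).
rewrite (bigD1 j)//= eqxx mul1r mulr1 big1 ?addr0; first by ring.
by move=> l /negbTE ->; rewrite mul0r mulr0 addr0 mulr0.
Qed.

Lemma tangencyP x i : x 0 i != 0 ->
  tangency x <-> forall j, gradf x j * x 0 i = gradf x i * x 0 j.
Proof.
move=> xi; split => [h j|h j k]; first exact: h.
by apply: (mulIf xi); rewrite mulrAC h mulrAC -mulrA mulrCA [RHS]mulrAC h; ring.
Qed.

Lemma near0_forall (I : finType) (Q : I -> set 'rV[R]_d) :
  (forall k, \forall x \near (0 : 'rV[R]_d), Q k x) ->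
  \forall x \near (0 : 'rV[R]_d), forall k, Q k x.
Proof. exact: (@filter_forall _ I Q (nbhs (0 : 'rV[R]_d)) (nbhs_filter _)). Qed.

Lemma continuous_locally_bounded (phi : 'rV[R]_d -> R) : {for 0, continuous phi} ->
  \forall x \near (0 : 'rV[R]_d), `|phi x| <= `|phi 0| + 1.
Proof.
move=> /cvgrPdist_le /(_ 1 ltr01); apply: filterS => x h.
by rewrite -[phi x](subKr (phi 0)); apply: le_trans (ler_normB _ _) _; rewrite lerD2l.
Qed.

Variable U0 : set 'rV[R]_d.
Hypotheses (oU0 : open U0) (U00 : U0 0) (sH : smooth_on U0 H).

Lemma Ck_dH k j l : Ck k U0 (fun x => dH x j l).
Proof. by have [_ h] := sH k.+1; exact: (Ck_coord oU0 0 l (h (delta_mx 0 j))). Qed.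

Variable i : 'I_d.
Hypothesis Hi : forall j, j != i -> H 0 0 i != H 0 0 j.

(** For x = t (e_i + w) with w_i = 0 and j <> i, g_i = 2 h_i t + t^2 q_i and g_j = 2 h_j t w_j + t^2
    q_j, so g_j x_i = g_i x_j divided by t^2 reads 2 (h_i - h_j) w_j = t (q_j - q_i w_j). Division
    by 2 (h_i - h_j), nonzero near 0, gives [P]. *)
Lemma arc_exists : exists (e : R) (om : R -> 'rV[R]_d),
  [/\ 0 < e, forall k, Ck k [set t | `|t| < e] om, forall t, `|t| < e -> om t 0 i = 0,
    forall t, `|t| < e -> `|om t| <= 1 &
    forall x, `|x| < e -> x 0 i != 0 -> (forall j, `|x 0 j| <= `|x 0 i|) ->
      (tangency x <-> x = x 0 i *: (delta_mx 0 i + om (x 0 i)))].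
Proof.
(* The value 0 at j = i makes the i-th entry of [P], and hence of [om], vanish. *)
pose phi j x : R := if j == i then 0 else (2 * (H x 0 i - H x 0 j))^-1.
have cH l : {for 0, continuous (fun x => H x 0 l)}.
  by apply: (Ck_continuous (k := 0) (U := U0)) => //; apply: Ck_coord => //; exact: sH.
have n0 : \forall x \near (0 : 'rV[R]_d), forall j, j != i -> H x 0 i - H x 0 j != 0.
  apply: (near0_forall (Q := fun j x => j != i -> H x 0 i - H x 0 j != 0)) => j.
  have [->|ji] := eqVneq j i; first by apply: (@nearW _ (nbhs (0 : 'rV[R]_d)) _ (nbhs_filter _)).
  have h : {for 0, continuous (fun x => H x 0 i - H x 0 j)} by exact: (cvgB (cH i) (cH j)).
  have nb : nbhs (H 0 0 i - H 0 0 j) [set y | y != 0].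
    by apply: open_nbhs_nbhs; split; [exact: open_neq|rewrite /= subr_eq0 Hi].
  have hn : \forall x \near (0 : 'rV[R]_d), H x 0 i - H x 0 j != 0 := h _ nb.
  by apply: filterS hn.
have /nbhs_ballP[d1 /= d10 hd1] : \forall x \near (0 : 'rV[R]_d),
    U0 x /\ forall j, j != i -> H x 0 i - H x 0 j != 0.
  by apply: filterI => //; exact: open_nbhs_nbhs.
pose B1 := ball (0 : 'rV[R]_d) d1.
have oB1 : open B1 by exact: ball_open.
have B1U : B1 `<=` U0 by move=> x /hd1[].
have B1H x j : B1 x -> j != i -> H x 0 i - H x 0 j != 0 by move=> /hd1[_]; apply.
have sphi k j : Ck k B1 (phi j).
  rewrite /phi; have [ji|ji] := eqVneq j i; first exact: Ck_cst.
  apply: Ck_inv => //; first by move=> x Bx; rewrite mulf_neq0// B1H.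
  apply: Ck_mul => //; first exact: Ck_cst.
  have c l : Ck k B1 (fun x => H x 0 l) by apply: Ck_coord => //; apply: Ck_sub B1U _; exact: sH.
  by apply: Ck_add => //; exact: Ck_opp.
pose eta (z : R * 'rV[R]_d) := z.1 *: (delta_mx 0 i + z.2).
pose q j (z : R * 'rV[R]_d) := \sum_l dH (eta z) j l * (delta_mx 0 i + z.2) 0 l ^+ 2.
pose P (z : R * 'rV[R]_d) : 'rV[R]_d := \row_j ((q j z - q i z * z.2 0 j) * phi j (eta z)).
pose O := eta @^-1` B1.
have seta k (D : set (R * 'rV[R]_d)) : open D -> Ck k D eta.
  move=> oD; apply: Ck_mx => // a j.
  have c : Ck k D (fun z : R * 'rV[R]_d => z.1 * (delta_mx 0 i + z.2) a j).
    apply: Ck_mul => //; first by apply: Ck_fst => //; exact: Ck_id.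
    apply: Ck_coord => //; apply: Ck_add => //; first exact: Ck_cst.
    by apply: Ck_snd => //; exact: Ck_id.
  by apply: (Ck_ext oD _ c) => z _; rewrite [RHS]mxE.
have oO : open O by apply: open_comp => // z _; exact: (seta 0%N setT openT z I).
have O0 : O (0, 0) by rewrite /O /= /eta /= scale0r; exact: ballxx.
have fR : fin_dim 'rV[R]_d by exact: fin_dim_mx.
have cw k a j : Ck k O (fun z : R * 'rV[R]_d => (delta_mx 0 i + z.2) a j).
  apply: Ck_coord => //; apply: Ck_add => //; first exact: Ck_cst.
  by apply: Ck_snd => //; exact: Ck_id.
have sq k j : Ck k O (q j).
  apply: Ck_sum => // l; apply: Ck_mul => //; last by apply: Ck_mul => //; exact: cw.
  apply: (Ck_comp (f := fun x => dH x j l) oO oB1 fR fin_dim_R) => //; last exact: seta.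
  by apply: Ck_sub B1U _; exact: Ck_dH.
have sP : smooth_on O P.
  move=> k; apply: Ck_mx => // a j.
  have c : Ck k O (fun z => (q j z + - (q i z * z.2 0 j)) * phi j (eta z)).
    apply: Ck_mul => //.
      apply: Ck_add => //; apply: Ck_opp => //; apply: Ck_mul => //.
      by apply: Ck_coord => //; apply: Ck_snd => //; exact: Ck_id.
    by apply: (Ck_comp (f := phi j) oO oB1 fR fin_dim_R) => //; exact: seta.
  by apply: (Ck_ext oO _ c) => z _; rewrite [RHS]mxE.
have [e0 [r [om [e00 /andP[r0 r1] som omP omu]]]] := implicit_arc oO O0 sP.
have nb : \forall x \near (0 : 'rV[R]_d), (forall j, `|phi j x| <= `|phi j 0| + 1) /\
    (forall p : 'I_d * 'I_d, `|dH x p.1 p.2| <= `|dH 0 p.1 p.2| + 1).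
  apply: filterI; apply: near0_forall => j; apply: continuous_locally_bounded.
    by apply: (Ck_continuous (sphi 0%N j)); exact: ballxx.
  exact: (Ck_continuous (Ck_dH 0 j.1 j.2)).
have /nbhs_ballP[d2 /= d20 hd2] := nb.
pose Bq := \sum_p (`|dH 0 p.1 p.2| + 1).
pose Bp := \sum_j (`|phi j 0| + 1).
have Bq0 : 0 <= Bq by apply: sumr_ge0 => p _; rewrite addr_ge0.
have Bp0 : 0 <= Bp by apply: sumr_ge0 => p _; rewrite addr_ge0.
have Pb (t : R) (w : 'rV[R]_d) : ball (0 : 'rV[R]_d) d2 (eta (t, w)) -> `|w| <= 1 -> w 0 i = 0 ->
    `|P (t, w)| <= 2 * Bq * Bp.
  move=> /hd2[hp hq] w1 wi.
  have w1j l : `|(delta_mx 0 i + w) 0 l| <= 1.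
    rewrite !mxE eqxx /=; have [->|li] := eqVneq l i; first by rewrite wi addr0 normr1.
    by rewrite add0r; apply: le_trans w1; exact: rV_coord_le.
  have qb j : `|q j (t, w)| <= Bq.
    apply: (le_trans (ler_norm_sum _ _ _)).
    apply: (@le_trans _ _ (\sum_l (`|dH 0 j l| + 1))).
      apply: ler_sum => l _; rewrite normrM -[leRHS]mulr1; apply: ler_pM => //.
        exact: (hq (j, l)).
      by rewrite normrX exprn_ile1// w1j.
    rewrite /Bq -(pair_bigA _ (fun j l => `|dH 0 j l| + 1)) /= [leRHS](bigD1 j)//= lerDl.
    by apply: sumr_ge0 => ? _; apply: sumr_ge0 => ? _; rewrite addr_ge0.
  rewrite rV_norm_le ?mulr_ge0//; apply/forallP => j; rewrite mxE normrM.
  apply: ler_pM => //.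
    apply: (le_trans (ler_normB _ _)); rewrite mulr2n mulrDl !mul1r; apply: lerD => //.
    rewrite normrM -[leRHS]mulr1; apply: ler_pM => //.
    by apply: le_trans w1; exact: rV_coord_le.
  apply: (le_trans (hp j)); rewrite /Bp (bigD1 j)//= lerDl.
  by apply: sumr_ge0 => ? _; rewrite addr_ge0.
have Pi t w : P (t, w) 0 i = 0 by rewrite mxE /phi eqxx mulr0.
(* A point of the cone only has |w| <= 1, while uniqueness asks for |w| < r. Since w = t P(t, w) and
   |P| <= 2 Bq Bp, it suffices that |t| < r / C. *)
pose C := 2 * Bq * Bp + 1.
have C0 : 0 < C by rewrite ltr_wpDl// !mulr_ge0.
pose e := Num.min (Num.min e0 (r / C)) (Num.min d1 d2).
have e_gt0 : 0 < e by rewrite !lt_min e00 d10 d20 divr_gt0.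
have key t w : t != 0 -> B1 (eta (t, w)) -> w 0 i = 0 ->
    tangency (eta (t, w)) <-> w = t *: P (t, w).
  move=> t0 Bx wi; have etai : eta (t, w) 0 i = t.
    by rewrite /eta !mxE wi !eqxx addr0 mulr1.
  have xi : eta (t, w) 0 i != 0 by rewrite etai.
  apply: (iff_trans (tangencyP xi)); rewrite etai.
  have etaj j : j != i -> eta (t, w) 0 j = t * w 0 j.
    by move=> /negbTE ji; rewrite /eta !mxE ji andbF add0r.
  have gE j : gradf (eta (t, w)) j = 2 * H (eta (t, w)) 0 j * eta (t, w) 0 j + t ^+ 2 * q j (t, w).
    rewrite /gradf; congr (_ + _); rewrite /q mulr_sumr; apply: eq_bigr => l _.
    by rewrite [eta (t, w) 0 l]mxE /=; ring.
  have Hn j : j != i -> 2 * (H (eta (t, w)) 0 i - H (eta (t, w)) 0 j) != 0.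
    by move=> ji; rewrite mulf_neq0// B1H.
  split => [h|h j].
    apply/rowP => j; rewrite !mxE; have [->|ji] := eqVneq j i.
      by rewrite wi /phi eqxx !mulr0.
    rewrite /phi (negbTE ji) /=.
    have := h j; rewrite !gE etai etaj// => hj.
    have e1 : 2 * (H (eta (t, w)) 0 i - H (eta (t, w)) 0 j) * w 0 j =
        t * (q j (t, w) - q i (t, w) * w 0 j).
      by apply: (mulfI (mulf_neq0 t0 t0)); lra.
    by rewrite mulrA -e1 mulrAC mulfV ?mul1r ?Hn.
  have [->|ji] := eqVneq j i; first by rewrite etai.
  have e1 : 2 * (H (eta (t, w)) 0 i - H (eta (t, w)) 0 j) * w 0 j =
      t * (q j (t, w) - q i (t, w) * w 0 j).
    have /(congr1 (fun u : 'rV[R]_d => u 0 j)) := h; rewrite !mxE /phi (negbTE ji) /= => wj.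
    rewrite {1}wj; move: (Hn j ji); set D := 2 * _ => D0; rewrite mulrC -!mulrA mulVf ?mulr1//.
  rewrite !gE etai etaj//.
  have -> : (2 * H (eta (t, w)) 0 j * (t * w 0 j) + t ^+ 2 * q j (t, w)) * t =
    (2 * H (eta (t, w)) 0 i * t + t ^+ 2 * q i (t, w)) * (t * w 0 j) +
    t * t * (t * (q j (t, w) - q i (t, w) * w 0 j) -
      2 * (H (eta (t, w)) 0 i - H (eta (t, w)) 0 j) * w 0 j).
    by ring.
  by rewrite e1 subrr mulr0 addr0.
have omi t : `|t| < e0 -> om t 0 i = 0.
  by move=> te; have [_ ->] := omP t te; rewrite mxE Pi mulr0.
have lee : e <= e0 /\ (e <= r / C /\ (e <= d1 /\ e <= d2)).
  by rewrite /e !ge_min !lexx !orbT.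
have [ee0 [erC [ed1 ed2]]] := lee.
exists e, om; split => //.
- by move=> k; apply: Ck_sub (som k) => t /= te; exact: lt_le_trans ee0.
- by move=> t te; apply: omi; exact: lt_le_trans ee0.
- move=> t te; have [om1 _] := omP t (lt_le_trans te ee0).
  exact: le_trans (ltW om1) r1.
- move=> x xe xi xmax; set t := x 0 i.
  have te : `|t| < e by apply: le_lt_trans xe; exact: rV_coord_le.
  have te0 := lt_le_trans te ee0.
  have inB1 : B1 x by rewrite /B1 -ball_normE /= sub0r normrN; exact: lt_le_trans ed1.
  split => [tx|xE]; last first.
    have xeta : x = eta (t, om t) by [].
    rewrite xeta; apply/key => //; first by rewrite -xeta.
      exact: omi.
    by have [_] := omP t te0.
  pose w : 'rV[R]_d := t^-1 *: x - delta_mx 0 i.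
  have xeta : x = eta (t, w) by rewrite /eta /w /= subrKC scalerA mulfV// scale1r.
  have wi : w 0 i = 0 by rewrite !mxE !eqxx mulVf// subrr.
  have w1 : `|w| <= 1.
    rewrite rV_norm_le//; apply/forallP => j; have [->|ji] := eqVneq j i.
      by rewrite wi normr0.
    rewrite !mxE (negbTE ji) andbF subr0 normrM normfV mulrC ler_pdivrMr ?normr_gt0// mul1r.
    exact: xmax.
  have wE : w = t *: P (t, w).
    by apply/key => //; rewrite -xeta.
  rewrite -/(eta (t, om t)) {1}xeta; congr (eta (_, _)).
  apply: omu => //; rewrite wE normrZ.
  apply: (@le_lt_trans _ _ (`|t| * (2 * Bq * Bp))).
    apply: ler_wpM2l => //; apply: Pb => //.
    by rewrite -xeta -ball_normE /= sub0r normrN; exact: lt_le_trans ed2.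
  have : `|t| < r / C by exact: lt_le_trans erC.
  rewrite ltr_pdivlMr// => h; apply: le_lt_trans h; apply: ler_wpM2l => //.
  by rewrite /C lerDl.
Qed.

End Arcs.

(** * Charts straightening the arcs *)

Section ArcChart.
Context {R : realType} {n : nat}.
Variables (i : 'I_n.+1) (om : R -> 'rV[R]_n.+1) (e : R).
Hypotheses (som : forall k, Ck k [set t | `|t| < e] om)
  (omi : forall t, `|t| < e -> om t 0 i = 0).

Definition arc (t : R) : 'rV[R]_n.+1 := t *: (delta_mx 0 i + om t).

Lemma arc_coord t : `|t| < e -> arc t 0 i = t.
Proof. by move=> te; rewrite /arc !mxE omi// !eqxx addr0 mulr1. Qed.

Lemma arc_lift t k : arc t 0 (lift i k) = t * om t 0 (lift i k).
Proof. by rewrite /arc !mxE [lift i k == i]eq_sym (negbTE (neq_lift i k)) andbF add0r. Qed.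

Lemma arc0 : arc 0 = 0.
Proof. by rewrite /arc scale0r. Qed.

Lemma open_domain : open [set t : R | `|t| < e].
Proof.
by apply: (@open_comp _ _ (fun t : R => `|t|) [set x : R | x < e]);
  [move=> ? _; exact: norm_continuous|exact: open_lt].
Qed.

(** Subtracting x_i om(x_i) from the other coordinates straightens the arc over the whole strip
    where x_i is in I; s = 1 or -1 orients the parameter. The set A lets one chart serve inner
    points, with the full line, and the endpoint, with a half-line. *)
Lemma arc_chart (s t0 : R) (I : set R) (A : set 'rV[R]_1) (C : set 'rV[R]_n.+1) :
  s * s = 1 -> open I -> I `<=` [set t | `|t| < e] -> I (s * t0) ->
  (forall t, I t -> C (arc t) <-> A (const_mx (s * t - t0))) ->
  (forall x, C x -> I (x 0 i) -> x = arc (x 0 i)) ->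
  slice_chart n A C (arc (s * t0)).
Proof.
move=> ss oI Ie It0 CA Carc.
have fI : fin_dim R by exact: fin_dim_R.
have fn m : fin_dim 'rV[R]_m by exact: fin_dim_mx.
pose U := [set x : 'rV[R]_n.+1 | I (x 0 i)].
pose phi (x : 'rV[R]_n.+1) : 'rV[R]_1 * 'rV[R]_n :=
  (const_mx (s * x 0 i - t0), \row_k (x 0 (lift i k) - x 0 i * om (x 0 i) 0 (lift i k))).
pose sg (p : 'rV[R]_1 * 'rV[R]_n) := s * (p.1 0 0 + t0).
pose psi (p : 'rV[R]_1 * 'rV[R]_n) : 'rV[R]_n.+1 :=
  \row_j (if unlift i j is Some k then sg p * om (sg p) 0 j + p.2 0 k else sg p).
have sgphi x : sg (phi x) = x 0 i by rewrite /sg mxE subrK mulrA ss mul1r.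
have psiK x : psi (phi x) = x.
  apply/rowP => j; rewrite mxE sgphi; case: (unliftP i j) => [k ->|->//].
  by rewrite mxE addrC subrK.
have psii p : psi p 0 i = sg p by rewrite mxE unlift_none.
have phiK p : phi (psi p) = p.
  case: p => y z; congr pair.
    apply/rowP => j; rewrite ord1 mxE psii /sg /= mulrA ss mul1r addrK//.
  by apply/rowP => k; rewrite !mxE unlift_none liftK addrC addKr.
have UE : phi @` U = [set p | I (sg p)].
  apply/seteqP; split => [_ [x Ux <-]|p Ip]; first by rewrite /= sgphi.
  by exists (psi p); [rewrite /U /= psii|exact: phiK].
have cx k j (D : set 'rV[R]_n.+1) : open D -> Ck k D (fun x => x 0 j).
  by move=> oD; apply: Ck_coord => //; exact: Ck_id.
have oU : open U by apply: open_comp => // x _; exact: (cx 0%N i setT openT x Logic.I).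
have ssg k (D : set ('rV[R]_1 * 'rV[R]_n)) : open D -> Ck k D sg.
  move=> oD; apply: Ck_mul => //; first exact: Ck_cst.
  apply: Ck_add => //; last exact: Ck_cst.
  by apply: Ck_coord => //; apply: Ck_fst => //; exact: Ck_id.
have opU : open (phi @` U).
  by rewrite UE; apply: (@open_comp _ _ sg) => // p _; exact: (ssg 0%N setT openT p Logic.I).
exists U, phi; split.
- by rewrite /U /= arc_coord//; exact: Ie.
- split => //.
  + move=> k; apply: Ck_pair => //; apply: Ck_mx => // a j.
      have c : Ck k U (fun x => s * x 0 i + - t0).
        apply: Ck_add => //; last exact: Ck_cst.
        by apply: Ck_mul => //; [exact: Ck_cst|exact: cx].
      by apply: (Ck_ext oU _ c) => x _; rewrite mxE.
    have c : Ck k U (fun x => x 0 (lift i j) + - (x 0 i * (om \o (fun y => y 0 i)) x 0 (lift i j))).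
      apply: Ck_add => //; first exact: cx.
      apply: Ck_opp => //; apply: Ck_mul => //; first exact: cx.
      apply: Ck_coord => //; apply: (Ck_comp oU open_domain fI (fn _) _ (som k)); last exact: cx.
      by move=> x; exact: Ie.
    by apply: (Ck_ext oU _ c) => x _; rewrite mxE.
  + exists psi; split => [k|//]; apply: Ck_mx => // a j.
    case: (unliftP i j) => [l jl|ji].
      have c : Ck k (phi @` U) (fun p => sg p * (om \o sg) p 0 j + p.2 0 l).
        apply: Ck_add => //; last by apply: Ck_coord => //; apply: Ck_snd => //; exact: Ck_id.
        apply: Ck_mul => //; first exact: ssg.
        apply: Ck_coord => //.
        apply: (Ck_comp opU open_domain fI (fn _) _ (som k)); last exact: ssg.
        by rewrite UE => p; exact: Ie.
      by apply: (Ck_ext opU _ c) => p _; rewrite mxE jl liftK.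
    by apply: (Ck_ext opU _ (ssg k _ opU)) => p _; rewrite mxE ji unlift_none.
- rewrite /phi arc_coord; last exact: Ie.
  congr pair; first by apply/rowP => j; rewrite !mxE mulrA ss mul1r subrr.
  by apply/rowP => k; rewrite mxE arc_lift subrr mxE.
- have phi_arc x : U x -> (phi x).2 = 0 -> x = arc (x 0 i).
    move=> Ux /rowP h; apply/rowP => j; case: (unliftP i j) => [k ->|->].
      by rewrite arc_lift; apply/eqP; rewrite -subr_eq0; have := h k; rewrite !mxE => ->.
    by rewrite arc_coord//; exact: Ie.
  apply/seteqP; split => [_ [x [Cx Ux] <-]|p [[x Ux <-] [Ax x2]]].
    have xE := Carc x Cx Ux; split; first by exists x.
    split; last by apply/rowP => k; rewrite !mxE {1}xE arc_lift subrr.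
    by apply/(CA _ Ux); rewrite -xE.
  exists x => //; split => //; have xE := phi_arc x Ux x2.
  by rewrite xE; apply/(CA _ Ux).
Qed.

End ArcChart.

Section HalfArc.
Context {R : realType} {n : nat}.
Variables (i : 'I_n.+1) (om : R -> 'rV[R]_n.+1) (e : R) (b : bool).
Hypotheses (e0 : 0 < e) (som : forall k, Ck k [set t | `|t| < e] om)
  (omi : forall t, `|t| < e -> om t 0 i = 0).
Local Notation s := ((-1) ^+ b : R).

Definition half_arc : set 'rV[R]_n.+1 := [set arc i om (s * t) | t in [set t | 0 <= t < e]].

Let ss : s * s = 1. Proof. by rewrite -expr2 sqrr_sign. Qed.
Let sst t : s * (s * t) = t. Proof. by rewrite mulrA ss mul1r. Qed.
Let normst t : `|s * t| = `|t|. Proof. exact: normrMsign. Qed.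

Lemma half_arc_coord x : half_arc x -> x = arc i om (x 0 i).
Proof.
move=> [t /andP[t0 te] <-]; rewrite (arc_coord omi)//.
by rewrite normst ger0_norm.
Qed.

Lemma half_arcP t : `|t| < e -> half_arc (arc i om t) <-> 0 <= s * t.
Proof.
move=> te; split => [[u /andP[u0 ue] /(congr1 (fun x : 'rV[R]_n.+1 => x 0 i))]|st0].
  have ue' : `|s * u| < e by rewrite normst ger0_norm.
  by rewrite (arc_coord omi te) (arc_coord omi ue') => <-; rewrite sst.
exists (s * t); last by rewrite sst.
by rewrite /= st0 -(ger0_norm st0) normst.
Qed.

Lemma half_arc_submanifold_bd : submanifold_bd 1 n half_arc [set 0].
Proof.
have arcs0 : arc i om (s * 0) = 0 by rewrite mulr0 arc0.
have cs : continuous (fun t : R => s * t) by move=> t; apply: cvgM; [exact: cvg_cst|exact: cvg_id].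
split => [_ ->|p [[t /andP[t0 te] tp] p0]|_ ->].
- by exists 0 => //; rewrite /= lexx.
- have tgt : 0 < t.
    rewrite lt_neqAle t0 andbT; apply/eqP => tz; apply: p0.
    by rewrite /= -tp -tz.
  (* This I leaves out the origin and the opposite half, so the half-arc fills the line of the
     chart. *)
  rewrite -tp; apply: (arc_chart (I := [set u | 0 < s * u < e]) som omi ss) => //=.
  + rewrite (_ : [set u | _] = ((fun u => s * u) @^-1` [set x | 0 < x]) `&`
        ((fun u => s * u) @^-1` [set x | x < e])); last first.
      by apply/seteqP; split => [u /andP[]|u [h1 h2]] //; apply/andP.
    apply: openI; apply: open_comp => [u _|]; try exact: cs.
      exact: open_gt.
    exact: open_lt.
  + by move=> u /andP[u0 ue] /=; rewrite -normst ger0_norm// ltW.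
  + by rewrite sst tgt.
  + move=> u /andP[u0 ue]; split => // _; apply/half_arcP; last exact: ltW.
    by rewrite -normst ger0_norm// ltW.
  + by move=> x /half_arc_coord.
(* Around 0 the arc extends to both sides, and the half-arc is its part with s u >= 0. *)
- rewrite -arcs0; apply: (arc_chart (I := [set u | `|u| < e]) som omi ss) => //=.
  + exact: open_domain.
  + by rewrite mulr0 normr0.
  + move=> u ue; rewrite half_arcP// /half_space /= subr0.
    by split => [h j _|/(_ ord0 erefl)]; rewrite mxE.
  + by move=> x /half_arc_coord.
Qed.

Lemma half_arc_connected : connected half_arc.
Proof.
apply: connected_continuous_connected.
  apply/connected_intervalP => x y /= /andP[x0 xe] /andP[y0 ye] z /andP[xz zy].
  by rewrite (le_trans x0 xz) (le_lt_trans zy ye).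
have carc : Ck 0 [set t | `|t| < e] (arc i om).
  have oD := @open_domain R e; apply: Ck_mx => // a j.
  have c : Ck 0 [set t | `|t| < e] (fun t : R => t * (delta_mx 0 i + om t) a j).
    apply: Ck_mul => //; first exact: Ck_id.
    by apply: Ck_coord => //; apply: Ck_add => //; exact: Ck_cst.
  by apply: (Ck_ext oD _ c) => t _; rewrite [RHS]mxE.
apply: continuous_in_subspaceT => t; rewrite inE /= => /andP[t0 te].
have h1 : {for t, continuous (fun t : R => s * t)} by apply: cvgM; [exact: cvg_cst|exact: cvg_id].
by apply: (continuous_comp h1); apply: carc; rewrite /= normst ger0_norm.
Qed.

End HalfArc.

(** * The tangency set as a union of half-arcs *)

Section Tangency.
Context {R : realType} {n : nat}.
Variables (f : 'rV[R]_n.+1 -> R) (H : 'rV[R]_n.+1 -> 'rV[R]_n.+1).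
Hypotheses (H_smooth : smooth_at H 0)
  (fE : \forall x \near (0 : 'rV[R]_n.+1), f x = \sum_i H x 0 i * x 0 i ^+ 2).

Lemma mho_tangency : \forall x \near (0 : 'rV[R]_n.+1), mho f x <-> tangency H x.
Proof.
have [U0 [[oU0 U00] sH]] := H_smooth.
have nU : \forall x \near (0 : 'rV[R]_n.+1), U0 x by exact: open_nbhs_nbhs.
have := fE; move=> /nbhs_interior; apply: filterS2 nU => x Ux fx.
have dx : differentiable H x by case: (sH 1) => h _; exact: h.
have E j := derive_quadratic j dx fx.
by split => h j k; move: (h j k); rewrite !E.
Qed.

Lemma tangency0 : tangency H 0.
Proof. by move=> j k; rewrite !mxE !mulr0. Qed.

Hypothesis H_distinct : forall a b, a != b -> H 0 0 a != H 0 0 b.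

(** A point x <> 0 lies in the cone of an index i maximising |x_i|, where tangency means lying on
    the i-th arc; the sign of x_i selects the half. This gives one half-arc for each axis and
    sign. *)
Lemma mho_arcs : exists (U : set 'rV[R]_n.+1) (m : nat) (C : 'I_m -> set 'rV[R]_n.+1),
  [/\ open_nbhs (0 : 'rV[R]_n.+1) U, mho f `&` U = \bigcup_i C i &
      forall i, connected (C i) /\ submanifold_bd 1 n (C i) [set 0]].
Proof.
have [U0 [[oU0 U00] sH]] := H_smooth.
have Hi i j : j != i -> H 0 0 i != H 0 0 j by rewrite eq_sym; exact: H_distinct.
have /choice[ei /choice[om omP]] := fun i => arc_exists oU0 U00 sH (Hi i).
have /nbhs_ballP[d1 /= d10 hd1] := mho_tangency.
have [e [e0 ed1 eei]] : exists e : R, [/\ 0 < e, e <= d1 & forall i, e <= ei i].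
  have : \forall e \near (0 : R)^'+, forall i, e <= ei i.
    by apply: filter_forall => i; apply: nbhs_right_le; case: (omP i).
  move=> /(filterI (nbhs_right_le d10)) /(filterI (nbhs_right_gt 0)) h.
  by have [e [h1 [h2 h3]]] := @filter_ex _ _ (at_right_proper_filter (0 : R)) _ h; exists e.
have som i k : Ck k [set t | `|t| < e] (om i).
  by have [_ h _ _ _] := omP i; apply: Ck_sub (h k) => t /= te; exact: lt_le_trans (eei i).
have omi i (t : R) : `|t| < e -> om i t 0 i = 0.
  by move=> te; have [_ _ h _ _] := omP i; apply: h; exact: lt_le_trans (eei i).
have om1 i (t : R) : `|t| < e -> `|om i t| <= 1.
  by move=> te; have [_ _ _ h _] := omP i; apply: h; exact: lt_le_trans (eei i).
have omE i (x : 'rV[R]_n.+1) : `|x| < e -> x 0 i != 0 -> (forall j, `|x 0 j| <= `|x 0 i|) ->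
    (tangency H x <-> x = arc i (om i) (x 0 i)).
  by move=> xe; have [_ _ _ _ h] := omP i; apply: h; exact: lt_le_trans (eei i).
(* For the converse inclusion the arcs must stay in the cone where [omE] applies; this is the bound
   |om| <= 1. *)
have arc_le i (t : R) j : `|t| < e -> `|arc i (om i) t 0 j| <= `|t|.
  move=> te; case: (unliftP i j) => [k ->|->]; last by rewrite (arc_coord (omi i) te).
  rewrite arc_lift normrM ler_piMr//; apply: le_trans (om1 i t te).
  exact: rV_coord_le.
have bE (x : 'rV[R]_n.+1) : ball (0 : 'rV[R]_n.+1) e x <-> `|x| < e.
  by rewrite -ball_normE /= sub0r normrN.
have mhoE (x : 'rV[R]_n.+1) : `|x| < e -> (mho f x <-> tangency H x).
  move=> xe; apply: hd1; rewrite -ball_normE /= sub0r normrN; exact: lt_le_trans ed1.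
pose C (k : 'I_#|{: 'I_n.+1 * bool}|) :=
  half_arc (enum_val k).1 (om (enum_val k).1) e (enum_val k).2.
exists (ball 0 e), #|{: 'I_n.+1 * bool}|, C; split.
- by split; [exact: ball_open|exact: ballxx].
- apply/seteqP; split => [x [mx /bE xe]|x [k _ [t /andP[t0 te] tx]]].
    have tx : tangency H x by apply/mhoE.
    have [x0|xn0] := eqVneq x 0.
      (* The origin lies on every half-arc, so the choice is arbitrary. *)
      exists (enum_rank (ord0, true)) => //; rewrite /C enum_rankK /=.
      by exists 0; [rewrite /= lexx|rewrite mulr0 arc0 x0].
    have [i _ imax] := @arg_maxP _ R 'I_n.+1 ord0 xpredT (fun j => `|x 0 j|) isT.
    have xmax j : `|x 0 j| <= `|x 0 i| by exact: imax.
    have xi : x 0 i != 0.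
      apply: contraNneq xn0 => xi0; apply/eqP/rowP => j; rewrite mxE; apply/eqP.
      by rewrite -normr_le0; apply: le_trans (xmax j) _; rewrite xi0 normr0.
    exists (enum_rank (i, x 0 i < 0)) => //; rewrite /C enum_rankK /=.
    exists `|x 0 i|; first by rewrite /= normr_ge0 (le_lt_trans (rV_coord_le _ _) xe).
    by rewrite -realEsign ?num_real//; apply/esym/omE.
  move: tx; set i := (enum_val k).1; set b := (enum_val k).2 => tx.
  have te' : `|(-1) ^+ b * t| < e by rewrite normrMsign ger0_norm.
  have xi : x 0 i = (-1) ^+ b * t by rewrite -tx (arc_coord (omi i) te').
  have xle j : `|x 0 j| <= `|(-1) ^+ b * t| by rewrite -tx; exact: arc_le.
  have xe : `|x| < e.
    apply: le_lt_trans te'; rewrite rV_norm_le//; exact/forallP.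
  split; last exact/bE.
  apply/mhoE => //; have [t00|tn0] := eqVneq t 0.
    by rewrite -tx t00 mulr0 arc0; exact: tangency0.
  apply/(omE i) => //.
  - by rewrite xi mulf_neq0// signr_eq0.
  - by move=> j; rewrite xi.
  - by rewrite xi.
- move=> k; split.
    by apply: half_arc_connected; exact: som.
  by apply: half_arc_submanifold_bd => //; exact: omi.
Qed.

End Tangency.

(** Any two indices coincide in dimension 1, so the tangency set is everything, and a translation
    paired with a zero-dimensional factor is a chart. *)
Lemma mho_dim1 (R : realType) (f : 'rV[R]_1 -> R) :
  submanifold 1 0 (mho f `&` [set: 'rV[R]_1]).
Proof.
have oT : open [set: 'rV[R]_1] by exact: openT.
have mT : mho f = setT by apply/seteqP; split => // x _ i j; rewrite !ord1.
move=> p _; pose phi (x : 'rV[R]_1) : 'rV[R]_1 * 'rV[R]_0 := (x - p, 0).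
have phiK (z : 'rV[R]_1 * 'rV[R]_0) : phi (z.1 + p) = z.
  by case: z => y w; rewrite /phi /= addrK thinmx0.
have pT : phi @` setT = setT.
  by apply/seteqP; split => // z _; exists (z.1 + p).
exists setT, phi; split => //.
- rewrite /diffeo_on pT; split => //; first exact: openT.
    move=> k; apply: Ck_pair => //; last exact: Ck_cst.
    by apply: Ck_add => //; [exact: Ck_id|exact: Ck_cst].
  exists (fun z => z.1 + p); split; last by move=> x _; rewrite /= subrK.
  move=> k; apply: Ck_add; [exact: openT| |exact: Ck_cst].
  by apply: Ck_fst; [exact: openT|exact: Ck_id].
- by rewrite /phi subrr.
- rewrite mT !setIT pT; apply/seteqP; split => // z _; split => //.
  split => //; exact: thinmx0.
Qed.

Theorem proposition4p20 (R : realType) (d : nat) (d_gt0 : (0 < d)%N)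
    (f : 'rV[R]_d -> R) (H : 'rV[R]_d -> 'rV[R]_d)
    (f_Ce : in_Ce f) (H_smooth : smooth_at H 0)
    (fE : \forall x \near (0 : 'rV[R]_d), f x = \sum_i H x 0 i * x 0 i ^+ 2)
    (Ue : set (set (J1 R d))) (Ue_universal : is_universal_stratification Ue)
    (f_regular : mho_regular Ue H)
    (Ue' : set (J1 R d)) (Ue'_stratum : Ue Ue') (Ue'_jet : Ue' (jet1 H 0)) :
  [/\ has_codim d.-1 Ue' \/ has_codim d Ue',
      has_codim d.-1 Ue' ->
        exists U, open_nbhs (0 : 'rV[R]_d) U /\
                  submanifold 1 d.-1 (mho f `&` U) &
      has_codim d Ue' ->
        exists (U : set 'rV[R]_d) (n : nat) (C : 'I_n -> set 'rV[R]_d),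
          [/\ open_nbhs (0 : 'rV[R]_d) U,
              mho f `&` U = \bigcup_i C i &
              forall i, connected (C i) /\
                        submanifold_bd 1 d.-1 (C i) [set 0]]].
Proof.
have [wS _] := Ue_universal.
have [[_ sub _ _] _] := wS.
have tr : transverse_at (jet1 H) Ue' 0 by exact: (nbhs_singleton f_regular).
have UX := stratum_sub wS Ue'_stratum.
split.
- have [_ [k [c sU]]] := sub Ue' Ue'_stratum.
  have c_ge := codim_ge sU UX Ue'_jet; have c_le := codim_le sU Ue'_jet tr.
  have : (c == d.-1) || (c == d).
    move: c_ge; rewrite leq_eqVlt prednK// eq_sym => /orP[->//|dc].
    by rewrite [c == d]eqn_leq c_le dc orbT.
  by move=> /orP[/eqP cE|/eqP cE]; rewrite cE in sU; [left|right]; exists k.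
- move=> [k sU]; have [d1|d1] := leqP d 1.
    have E : d = 1%N by apply/eqP; rewrite eqn_leq d1.
    move: f {H H_smooth f_Ce fE Ue Ue_universal f_regular Ue' Ue'_stratum Ue'_jet wS sub tr UX sU}.
    rewrite E => f; exists setT; split; last exact: mho_dim1.
    by split => //; exact: openT.
  (* For d > 1 this alternative is void, since j^1H(0) lies in E. *)
  have := no_large_stratum wS Ue'_stratum sU _ d1 Ue'_jet erefl.
  by rewrite prednK// => /(_ (leqnn _)).
- move=> [k sU].
  have dist a b : a != b -> H 0 0 a != H 0 0 b.
    (* For d = 1 there are no two different indices to compare. *)
    have [d1|d1] := leqP d 1.
      have lt0 (l : 'I_d) : l = 0%N :> nat.
        by apply/eqP; rewrite -leqn0 -ltnS; exact: leq_trans (ltn_ord l) d1.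
      by case/eqP; apply/val_inj; rewrite /= !lt0.
    move=> ab; exact: (distinct_of_codim wS Ue'_stratum sU d1 Ue'_jet ab).
  move: f H d_gt0 H_smooth fE dist
    {Ue Ue_universal f_regular Ue' Ue'_stratum Ue'_jet wS sub tr UX sU f_Ce}.
  case: d => // n f H _ H_smooth fE dist.
  exact: mho_arcs H_smooth fE dist.
Qed.
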